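(* Let $n\ge 2$, $p\in\{2,\dots,n-1\}$, and let $g$ be a complex polynomial with $g(0)\ne 0$ and $\deg(g)<n-p$. Let $A=[a_{ij}]\in\mathcal{M}_n(\mathbb{C})$ be non-derogatory, with $\sigma(A)=\{\lambda_1,\dots,\lambda_k\}$, where the $\lambda_i$ are pairwise distinct and have algebraic multiplicities $\alpha_1,\dots,\alpha_k$. Then all the nilpotent solutions $X\in\mathcal{M}_n(\mathbb{C})$ of the equation $$XA-AX=X^pg(X)$$ can be explicitly determined. Moreover, a nilpotent solution $X$ of this equation has its coefficients in $$\mathbb{Q}\big((a_{ij})_{i,j},\,(\lambda_i)_{1\le i\le k},\,(u_{1,\alpha_i},\dots,u_{\alpha_i-1,\alpha_i})_{1\le i\le k}\big),$$ where, for each $i$, the parameters $(u_{1,\alpha_i},\dots,u_{\alpha_i-1,\alpha_i})$ are those chosen as the last column of the $i$-th block in the block-by-block calculation of $X$ described in the context. In particular, the general nilpotent solution $X$ depends on $n-k$ parameters.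
   Context: $\sigma(A)$ is the spectrum of $A$. A complex square matrix is non-derogatory if, in its Jordan normal form, there is exactly one Jordan block for each eigenvalue. $J_m$ is the $m\times m$ nilpotent Jordan block, with $1$ on the first superdiagonal and $0$ elsewhere. The calculation of the nilpotent solutions is as follows. Take an invertible $P$ with $P^{-1}AP=\bigoplus_{i=1}^k(\lambda_iI_{\alpha_i}+J_{\alpha_i})$. A nilpotent solution $X$ has the form $P^{-1}XP=\bigoplus_{i=1}^kX_i$, where each $X_i$ is a nilpotent $\alpha_i\times\alpha_i$ matrix satisfying $X_iJ_{\alpha_i}-J_{\alpha_i}X_i=X_i^pg(X_i)$. Each such $X_i$ is strictly upper triangular. Its last column $(u_{1,\alpha_i},\dots,u_{\alpha_i-1,\alpha_i},0)^T$ is chosen arbitrarily subject to $1-j\kappa\,u_{\alpha_i-1,\alpha_i}\ne0$ for all $j\in\{1,\dots,\alpha_i-2\}$, where $\kappa$ is the coefficient of degree two of the polynomial $X^pg(X)$. The other coefficients of $X_i$ are then obtained recursively by solving equations of degree one. The symbols $u_{\cdot,\alpha_i}$ denote the parameters attached to the $i$-th block.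
   Formalization: The coefficients of g are adjoined to the field (without them the claim fails, e.g. n=3, p=2, g=π, A=J_3), and the field claim is stated for those P with entries in Q((a_ij),(λ_i)), which are proved to exist, since it fails for arbitrary P. *)

(* Defs.v *)
From HB Require Import structures.
From mathcomp Require Import all_boot all_order all_algebra.
From mathcomp Require Import complex reals.

Set Implicit Arguments.
Unset Strict Implicit.
Unset Printing Implicit Defensive.

Import Order.TTheory GRing.Theory Num.Theory.
Local Open Scope ring_scope.

(* [horner_mx] is only available in sizes of the form n.+1. *)
Definition horner_sqmx (F : fieldType) (m : nat) (X : 'M[F]_m) (q : {poly F}) :
  'M[F]_m := \sum_(i < size q) q`_i *: X ^+ i.

Definition nilpotent_mx (F : fieldType) (m : nat) (X : 'M[F]_m) : Prop :=
  exists N : nat, X ^+ N = 0.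

Definition nilp_jordan (F : fieldType) (m : nat) : 'M[F]_m :=
  \matrix_(i < m, j < m) (j == i.+1 :> nat)%:R.

Definition jordan_block (F : fieldType) (m : nat) (a : F) : 'M[F]_m :=
  a%:M + nilp_jordan F m.

Definition block_diag (F : fieldType) (n k : nat) (al : 'I_k -> nat)
    (en : (\sum_(i < k) al i)%N = n) (B : forall i : 'I_k, 'M[F]_(al i)) :
  'M[F]_n := castmx (en, en) (\mxdiag_(i < k) B i).

Definition jordan_reduction (F : fieldType) (n k : nat) (lam : 'I_k -> F)
    (al : 'I_k -> nat) (en : (\sum_(i < k) al i)%N = n) (A P : 'M[F]_n) : Prop :=
  P \in unitmx /\
  invmx P *m A *m P = block_diag en (fun i => jordan_block (al i) (lam i)).

Definition non_derogatory (F : fieldType) (n : nat) (A : 'M[F]_n) : Prop :=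
  exists (k : nat) (lam : 'I_k -> F) (al : 'I_k -> nat)
         (en : (\sum_(i < k) al i)%N = n) (P : 'M[F]_n),
    [/\ injective lam, forall i, (0 < al i)%N & jordan_reduction lam en A P].

Definition nilpotent_solution (F : fieldType) (p : nat) (g : {poly F}) (m : nat)
    (A X : 'M[F]_m) : Prop :=
  nilpotent_mx X /\ X *m A - A *m X = X ^+ p *m horner_sqmx X g.

Definition strictly_upper (F : fieldType) (m : nat) (Y : 'M[F]_m) : Prop :=
  forall i j : 'I_m, (j <= i)%N -> Y i j = 0.

(* The last column without its bottom entry, i.e. (u_1, ..., u_{m-1}). *)
Definition last_col (F : fieldType) (m : nat) : 'M[F]_m -> 'cV[F]_m.-1 :=
  match m with
  | 0 => fun _ => 0
  | m'.+1 => fun Y => \col_(r < m') Y (widen_ord (leqnSn m') r) ord_max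
  end.

(* The matrix whose last column is (u_1, ..., u_{m-1}, 0)^T, and 0 elsewhere. *)
Definition last_col_mx (F : fieldType) (m : nat) (u : 'cV[F]_m.-1) : 'M[F]_m :=
  \matrix_(i < m, j < m)
    if (j.+1 == m :> nat) then oapp (fun r : 'I_m.-1 => u r 0) 0 (insub (i : nat))
    else 0.

Definition kappa (F : fieldType) (p : nat) (g : {poly F}) : F := ('X^p * g)`_2.

(* The index r ranges over the (at most one) bottom position of u, so that
   u r 0 is u_{m-1,m} in 1-based notation; no condition when m <= 2. *)
Definition admissible (F : fieldType) (p : nat) (g : {poly F}) (m : nat)
    (u : 'cV[F]_m.-1) : Prop :=
  forall r : 'I_m.-1, r.+2 = m :> nat ->
  forall j : nat, (1 <= j <= m - 2)%N -> 1 - j%:R * kappa p g * u r 0 != 0.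

(* Positions (i, j) with i < j < m - 1 (0-based), one superdiagonal after the
   other, each one from bottom to top. *)
Definition solving_order (m : nat) : seq ('I_m * 'I_m) :=
  flatten [seq [seq ij : 'I_m * 'I_m <-
                  [seq (i, j) | i <- rev (enum 'I_m), j <- enum 'I_m]
                | (ij.2 == ij.1 + d :> nat)%N && (ij.2.+1 < m)%N]
          | d <- iota 1 (m - 2)].

(* Right multiplication by J^T shifts columns: (M *m J^T) i j = M i (j+1).
   With Y holding the entries already known, and 0 at the others, the
   coefficient (i, j+1) of X J - J X = X^p g(X) is an equation of degree one in
   the unknown t = X i j, namely
     t - Y (i+1) (j+1) = (Y^p g(Y)) i (j+1) + t * kappa * Y j (j+1). *)
Definition entry_solution (F : fieldType) (p : nat) (g : {poly F}) (m : nat)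
    (Y : 'M[F]_m) (i j : 'I_m) : F :=
  let J := nilp_jordan F m in
  ((J *m Y *m J^T) i j + (Y ^+ p *m horner_sqmx Y g *m J^T) i j)
    / (1 - kappa p g * (Y *m J^T) j j).

Definition block_solution (F : fieldType) (p : nat) (g : {poly F}) (m : nat)
    (u : 'cV[F]_m.-1) : 'M[F]_m :=
  foldl (fun Y ij => Y + entry_solution p g Y ij.1 ij.2 *: delta_mx ij.1 ij.2)
        (last_col_mx u) (solving_order m).

(* Membership in Q(S), the intersection of all the subfields containing S. *)
Definition in_Qadjoin (F : fieldType) (S : F -> Prop) (x : F) : Prop :=
  forall K : {pred F}, divring_closed K -> (forall y, S y -> y \in K) -> x \in K.

Definition data_gens (F : fieldType) (n k : nat) (A : 'M[F]_n) (lam : 'I_k -> F)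
    (y : F) : Prop :=
  (exists r c, y = A r c) \/ (exists i, y = lam i).

(* The coefficients of g have to be adjoined as well: for n = 3, p = 2, g = c
   constant and A the nilpotent Jordan block, the solution with last column
   (0, 1, 0)^T has the entry 1 / (1 - c) in position (1, 2). *)
Definition solution_gens (F : fieldType) (g : {poly F}) (n k : nat)
    (A : 'M[F]_n) (lam : 'I_k -> F) (al : 'I_k -> nat)
    (u : forall i : 'I_k, 'cV[F]_(al i).-1) (y : F) : Prop :=
  [\/ data_gens A lam y, exists i r, y = u i r 0 | exists s : nat, y = g`_s].

(* Main.v *)
Require Import Defs.
From HB Require Import structures.
From mathcomp Require Import all_boot all_order all_algebra.
From mathcomp Require Import complex reals zify ring.

Set Implicit Arguments.
Unset Strict Implicit.
Unset Printing Implicit Defensive.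

Import Order.TTheory GRing.Theory Num.Theory.
Local Open Scope ring_scope.

(** Write f = X^p g, so that the equation is [X, A] = f(X) with f of order at
    least two, and let kappa be the coefficient of degree two of f.

    Reduction to blocks.  For a polynomial q one has [A, q(X)] = - (q' f)(X), so
    each commutator with A raises the order in X of a polynomial in X.  As X is
    nilpotent, an iterated commutator of A with X vanishes
    ([iter_commutator_nilpotent]).  In a Jordan basis of A the block (i, l) of
    this iterate is an iterate of Z |-> J_i Z - Z J_l, which is injective when
    the eigenvalues differ ([jordan_block_sylvester]).  Hence X is block
    diagonal, and each block B is a nilpotent solution for the nilpotent Jordan
    block J.  The kernel of B is stable by J, so it contains the first basis
    vector; dividing by it, B is strictly upper triangular by induction on its
    size ([nilpotent_solution_strictly_upper]).

    Calculation of a block.  The coefficient (i, j+1) of [B, J] = f(B), for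
    i < j, reads B(i, j) - B(i+1, j+1) = f(B)(i, j+1).  By strict triangularity,
    B(i, j) occurs on the right only in the product kappa B(i, j) B(j, j+1)
    ([horner_sqmx_agree_before]), and all the other entries that occur come
    earlier in the solving order or lie in the last column.  So the equation is
    of degree one in B(i, j), with leading coefficient 1 - kappa B(j, j+1).  On
    the first superdiagonal it is a Riccati recursion: if c is the bottom entry
    of this superdiagonal, the entry r places above is c / (1 - r kappa c)
    ([superdiagonal_closed_form]).  Therefore the leading coefficients are all
    nonzero exactly when the last column is admissible, and then the last column
    determines a unique solution ([solution_unique],
    [block_solution_solution]).

    Rationality.  Let q_i be the product of the factors of the characteristic
    polynomial at the eigenvalues other than lam_i.  Since A is non-derogatory,
    (A - lam_i)^(al_i - 1) q_i(A) is nonzero, so one of its columns, say of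
    index c_i, is nonzero; the vectors (A - lam_i)^s q_i(A) e_(c_i), for s < al_i
    and all i, form a Jordan basis with coefficients in Q(A, lam)
    ([jordan_basis_exists]).  The recursion that computes the blocks only uses
    the field operations. *)

(** * Polynomials in a square matrix of any size *)

Section SquareMatrixPolynomials.
Context {F : fieldType}.
Implicit Types (q : {poly F}).

Lemma horner_sqmxE n (A : 'M[F]_n.+1) q : horner_sqmx A q = horner_mx A q.
Proof.
rewrite -[in RHS](coefK q) poly_def raddf_sum /=; apply: eq_bigr => i _.
by rewrite horner_mxZ rmorphXn /= horner_mx_X.
Qed.

Lemma expmx_mul_horner_sqmx m (X : 'M[F]_m) (g : {poly F}) (e : nat) :
  X ^+ e *m horner_sqmx X g = horner_sqmx X ('X^e * g).
Proof.
case: m X => [|m] X; first by apply/matrixP => - [].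
by rewrite !horner_sqmxE rmorphM rmorphXn /= horner_mx_X.
Qed.

Lemma expmx_intertwine m n (X : 'M[F]_m) (Y : 'M[F]_n) (T : 'M[F]_(m, n)) e :
  X *m T = T *m Y -> X ^+ e *m T = T *m Y ^+ e.
Proof.
move=> XT; elim: e => [|e IH]; first by rewrite !expr0 mul1mx mulmx1.
by rewrite !exprS -!mulmxE -mulmxA IH mulmxA XT mulmxA.
Qed.

Lemma horner_sqmx_intertwine m n (X : 'M[F]_m) (Y : 'M[F]_n)
    (T : 'M[F]_(m, n)) q :
  X *m T = T *m Y -> horner_sqmx X q *m T = T *m horner_sqmx Y q.
Proof.
move=> XT; rewrite mulmx_suml mulmx_sumr; apply: eq_bigr => i _.
by rewrite -scalemxAl (expmx_intertwine _ XT) scalemxAr.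
Qed.

End SquareMatrixPolynomials.

(** * The nilpotent Jordan block *)

Section NilpotentJordanBlock.
Context {F : fieldType}.

Local Notation J m := (nilp_jordan F m).

(** Left multiplication by the Jordan block shifts the rows up, and right
    multiplication shifts the columns to the right. *)
Lemma nilp_jordan_mulmx m n (M : 'M[F]_(m, n)) (i i1 : 'I_m) j :
  i1 = i.+1 :> nat -> (J m *m M) i j = M i1 j.
Proof.
move=> i1E; rewrite !mxE (bigD1 i1) //= !mxE i1E eqxx mul1r big1 ?addr0 //.
by move=> l; rewrite -val_eqE /= i1E => /negPf nl; rewrite !mxE nl mul0r.
Qed.

Lemma nilp_jordan_mulmx_last m n (M : 'M[F]_(m, n)) (i : 'I_m) j :
  i.+1 = m -> (J m *m M) i j = 0.
Proof.
move=> im; rewrite !mxE big1 // => l _; rewrite !mxE im.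
by rewrite (ltn_eqF (ltn_ord l)) mul0r.
Qed.

Lemma mulmx_nilp_jordan m n (M : 'M[F]_(n, m)) i (j j1 : 'I_m) :
  j1 = j.+1 :> nat -> (M *m J m) i j1 = M i j.
Proof.
move=> j1E; rewrite !mxE (bigD1 j) //= !mxE j1E eqxx mulr1 big1 ?addr0 //.
move=> l; rewrite -val_eqE => nl.
by rewrite !mxE j1E eqSS eq_sym (negPf nl) mulr0.
Qed.

Lemma mulmx_nilp_jordan0 m n (M : 'M[F]_(n, m)) i (j : 'I_m) :
  j = 0%N :> nat -> (M *m J m) i j = 0.
Proof. by move=> j0; rewrite !mxE big1 // => l _; rewrite !mxE j0 mulr0. Qed.

Lemma mulmx_nilp_jordan_tr m n (M : 'M[F]_(n, m)) i (j j1 : 'I_m) :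
  j1 = j.+1 :> nat -> (M *m (J m)^T) i j = M i j1.
Proof.
move=> j1E; rewrite -[_ *m _]trmxK trmx_mul trmxK [LHS]mxE.
by rewrite (nilp_jordan_mulmx _ _ j1E) mxE.
Qed.

Lemma expmx_nilp_jordan m s (i j : 'I_m) :
  (J m ^+ s) i j = (j == (i + s)%N :> nat)%:R.
Proof.
elim: s i => [|s IH] i.
  by rewrite expr0 !mxE addn0 -val_eqE [in RHS]eq_sym.
rewrite exprS -mulmxE; case: (ltnP i.+1 m) => [lti|lei].
  rewrite (nilp_jordan_mulmx _ _ (erefl : Ordinal lti = i.+1 :> nat)).
  by rewrite IH /= addSnnS.
rewrite nilp_jordan_mulmx_last; last by apply/eqP; rewrite eqn_leq ltn_ord.
case: eqP => // jE; have := ltn_ord j; rewrite jE => jm.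
by move: (leq_trans jm lei); rewrite -addSnnS ltnNge leq_addr.
Qed.

Lemma expmx_nilp_jordan0 m : J m ^+ m = 0.
Proof.
apply/matrixP => i j; rewrite expmx_nilp_jordan mxE.
by rewrite (ltn_eqF (leq_trans (ltn_ord j) (leq_addl i m))).
Qed.

(** In particular every nonzero subspace stable by the Jordan block contains the
    first basis vector. *)
Lemma expmx_nilp_jordan_delta m (v : 'cV[F]_m.+1) : v != 0 ->
  exists s, exists2 a, a != 0 & J m.+1 ^+ s *m v = a *: delta_mx ord0 ord0.
Proof.
move=> vn0.
have [i0 vi0] : exists i, v i 0 != 0.
  apply/existsP; apply: contraNT vn0; rewrite negb_exists => /forallP v0.
  apply/eqP/matrixP => i j; rewrite ord1 mxE; apply/eqP.
  by have := v0 i; rewrite negbK.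
(* The largest index of a nonzero entry is brought to the first place. *)
case: (@arg_maxnP _ i0 (fun i => v i 0 != 0) val vi0) => s vs smax.
exists s, (v s 0) => //; apply/matrixP => i j; rewrite {j}ord1 mxE.
under eq_bigr do rewrite expmx_nilp_jordan.
rewrite !mxE eqxx andbT; case: eqVneq => [->|in0] /=.
  rewrite mulr1 (bigD1 s) //= add0n eqxx mul1r big1 ?addr0 // => l.
  by rewrite -val_eqE /= => /negPf ->; rewrite mul0r.
rewrite mulr0 big1 // => l _; case: eqP => [lE|_]; last by rewrite mul0r.
rewrite mul1r; apply/eqP; apply: contraNT in0 => /smax /=; rewrite lE.
by rewrite -val_eqE /= -{2}[nat_of_ord s]add0n leq_add2r leqn0.
Qed.

Lemma nilpotent_mx_kernel m (X : 'M[F]_m.+1) : nilpotent_mx X ->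
  exists2 v : 'cV[F]_m.+1, v != 0 & X *m v = 0.
Proof.
case=> N XN0; have exN : exists e, X ^+ e == 0 by exists N; rewrite XN0.
case: (ex_minnP exN) => [[|e]] => [|/eqP Xe0 emin]; first by rewrite expr0 oner_eq0.
have Xen0 : X ^+ e != 0 by apply/negP => /emin; rewrite ltnn.
have [j vn0] : exists j, col j (X ^+ e) != 0.
  apply/existsP; apply: contraNT Xen0; rewrite negb_exists => /forallP c0.
  apply/eqP/matrixP => i j; have := c0 j; rewrite negbK => /eqP/matrixP/(_ i 0).
  by rewrite !mxE.
by exists (col j (X ^+ e)) => //; rewrite colE mulmxA mulmxE -exprS Xe0 mul0mx.
Qed.

Lemma strictly_upper_expmx m (Y : 'M[F]_m) e (i j : 'I_m) :
  strictly_upper Y -> (j < i + e)%N -> (Y ^+ e) i j = 0.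
Proof.
move=> upY; elim: e i => [|e IH] i ltj.
  by rewrite addn0 in ltj; rewrite expr0 mxE -val_eqE gtn_eqF.
rewrite exprS -mulmxE mxE big1 // => l _; case: (leqP l i) => [li|il].
  by rewrite upY // mul0r.
by rewrite IH ?mulr0 // (leq_trans ltj) // -addSnnS leq_add2r.
Qed.

Lemma strictly_upper_nilpotent m (Y : 'M[F]_m) : strictly_upper Y -> nilpotent_mx Y.
Proof.
move=> upY; exists m; apply/matrixP => i j; rewrite strictly_upper_expmx ?mxE //.
exact: leq_trans (ltn_ord j) (leq_addl _ _).
Qed.

Lemma comm_mx_expmx m (X Y : 'M[F]_m) e : comm_mx X Y -> comm_mx X (Y ^+ e).
Proof. exact: commrX. Qed.

(** The matrix that deletes the first coordinate. *)
Let R m : 'M[F]_(m, m.+1) := rowsub (lift ord0) 1%:M.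

(* A matrix that kills the first basis vector acts on the quotient. *)
Let R_intertwine m (M : 'M[F]_m.+1) : (forall i, M i ord0 = 0) ->
  mxsub (lift ord0) (lift ord0) M *m R m = R m *m M.
Proof.
move=> M0; rewrite -rowsubE; apply/matrixP => i j.
rewrite [LHS]mxE [RHS]mxE; case: (unliftP ord0 j) => [l|] ->.
  rewrite (bigD1 l) //= !mxE eqxx mulr1 big1 ?addr0 // => l' nl'.
  by rewrite !mxE (inj_eq lift_inj) (negPf nl') mulr0.
by rewrite M0 big1 // => l _; rewrite !mxE mulr0.
Qed.

Let R_tr m : R m *m (R m)^T = 1%:M.
Proof.
rewrite -rowsubE; apply/matrixP => i j; rewrite !mxE.
by rewrite (inj_eq lift_inj) eq_sym.
Qed.

(** The kernel of a solution is stable by the Jordan block, so it contains the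
    first basis vector; dividing by it yields a solution of smaller size. *)
Lemma nilpotent_solution_strictly_upper p (g : {poly F}) m (X : 'M[F]_m) :
  (0 < p)%N -> nilpotent_solution p g (J m) X -> strictly_upper X.
Proof.
move=> p_gt0; elim: m X => [|m IH] X; first by move=> _ [].
move=> [nilX eqX].
have kerJ (v : 'cV_m.+1) : X *m v = 0 -> X *m (J m.+1 *m v) = 0.
  move=> Xv; move/eqP: eqX; rewrite subr_eq => /eqP eqX.
  rewrite mulmxA eqX mulmxDl -[X in _ + X]mulmxA Xv mulmx0 addr0.
  rewrite expmx_mul_horner_sqmx.
  rewrite (@horner_sqmx_intertwine _ _ _ X 0 v) ?mulmx0 //.
  suff -> : horner_sqmx (0 : 'M[F]_1) ('X^p * g) = 0 by rewrite mulmx0.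
  by rewrite -expmx_mul_horner_sqmx -(prednK p_gt0) exprS mul0r mul0mx.
have X0 i : X i ord0 = 0.
  have [v vn0 Xv0] := nilpotent_mx_kernel nilX.
  have [s [a an0 sv]] := expmx_nilp_jordan_delta vn0.
  have : X *m (J m.+1 ^+ s *m v) = 0.
    elim: s {sv} => [|s IHs]; first by rewrite expr0 mul1mx.
    by rewrite exprS -mulmxE -mulmxA kerJ.
  rewrite sv -scalemxAr => /(congr1 ( *:%R a^-1)).
  rewrite scaler0 scalerA mulVf // scale1r -colE => /matrixP/(_ i ord0).
  by rewrite !mxE.
pose X' := mxsub (lift ord0) (lift ord0) X.
have X'R : X' *m R m = R m *m X by exact: R_intertwine.
have JR : J m *m R m = R m *m J m.+1.
  rewrite -R_intertwine; last by move=> i; rewrite mxE.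
  by congr (_ *m _); apply/matrixP => i j; rewrite !mxE !lift0 eqSS.
have upX' : strictly_upper X'.
  apply: IH; split.
    case: nilX => N XN0; exists N.
    rewrite -[LHS]mulmx1 -(R_tr m) mulmxA (expmx_intertwine _ X'R).
    by rewrite XN0 mulmx0 mul0mx.
  rewrite -[LHS]mulmx1 -[RHS]mulmx1 -(R_tr m) !mulmxA; congr (_ *m _).
  rewrite expmx_mul_horner_sqmx (horner_sqmx_intertwine _ X'R).
  rewrite -expmx_mul_horner_sqmx -eqX mulmxBl mulmxBr.
  by rewrite -!mulmxA JR X'R !mulmxA X'R JR.
move=> i j; case: (unliftP ord0 j) => [j'|] -> //.
case: (unliftP ord0 i) => [i'|] -> //; rewrite !lift0 ltnS => ji.
by have := upX' _ _ ji; rewrite mxE.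
Qed.

End NilpotentJordanBlock.

(** * The entries on which a coefficient of the equation depends *)

Section Dependency.
Context {F : fieldType}.
Implicit Types (f : {poly F}).

Lemma expmx_agree_below m (Y Z : 'M[F]_m) (i c : nat) q (a b : 'I_m) :
  strictly_upper Y -> strictly_upper Z ->
  (forall a b : 'I_m, (i < a)%N -> (b <= c)%N -> Z a b = Y a b) ->
  (i < a)%N -> (b <= c)%N -> (Z ^+ q) a b = (Y ^+ q) a b.
Proof.
move=> upY upZ agr ia bc; elim: q a ia => [|q IH] a ia; first by rewrite !expr0.
rewrite !exprS -!mulmxE !mxE; apply: eq_bigr => l _.
case: (leqP l a) => [la|al]; first by rewrite upY // upZ // !mul0r.
case: (leqP l b) => [lb|bl].
  by rewrite IH ?agr // ?(leq_trans lb) // (ltn_trans ia).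
by rewrite !strictly_upper_expmx ?mulr0 // (leq_trans bl) ?leq_addr.
Qed.

(** [Y] and [Z] agree on the entries that determine the entry (i, j) of a strictly
    upper triangular solution: in the columns up to j + 1, those below row i and
    those of row i to the left of column j. *)
Definition agree_before m (i j : 'I_m) (Y Z : 'M[F]_m) : Prop :=
  forall a b : 'I_m, (b <= j.+1)%N ->
    (i < a)%N || ((a == i) && (b < j)%N) -> Y a b = Z a b.

(** The entry (i, j) contributes to the entry (i, j+1) of a power of exponent at
    least two only through the product Z(i, j) Z(j, j+1) in the square. *)
Lemma expmx_agree_before m (Y Z : 'M[F]_m) (i j j1 : 'I_m) q :
  strictly_upper Y -> strictly_upper Z -> agree_before i j Y Z ->
  j1 = j.+1 :> nat -> (0 < q)%N ->
  (Z ^+ q.+1) i j1 - (Y ^+ q.+1) i j1 =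
    (q == 1%N)%:R * ((Z i j - Y i j) * Y j j1).
Proof.
move=> upY upZ agr j1E q_gt0; rewrite !exprS -!mulmxE !mxE -sumrB.
(* The last q factors only involve rows below i, where Y and Z agree. *)
have powE (l : 'I_m) : Z i l * (Z ^+ q) l j1 = Z i l * (Y ^+ q) l j1.
  case: (leqP l i) => [li|il]; first by rewrite upZ // !mul0r.
  congr (_ * _); apply: (@expmx_agree_below m Y Z i j1) => // a b ia bj.
  by rewrite agr ?ia // -j1E.
under eq_bigr do rewrite powE -mulrBl.
rewrite (bigD1 j) //= big1 ?addr0.
  case: q q_gt0 {powE} => [|[|q]] // _; first by rewrite expr1 eqxx mul1r.
  rewrite strictly_upper_expmx ?mulr0 ?mul0r //.
  by rewrite j1E -addSnnS -addSnnS ltnS leq_addr.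
move=> l; rewrite -val_eqE neq_ltn => /orP[lj|jl] /=.
  by rewrite agr ?subrr ?mul0r ?eqxx ?lj ?orbT // ltnW // ltnW // ltnS ltnW.
rewrite strictly_upper_expmx ?mulr0 // j1E (leq_trans (_ : _ <= l + 1)%N) //.
  by rewrite addn1 ltnS.
by rewrite leq_add2l.
Qed.

Lemma horner_sqmx_agree_before m f (Y Z : 'M[F]_m) (i j j1 : 'I_m) :
  f`_0 = 0 -> f`_1 = 0 ->
  strictly_upper Y -> strictly_upper Z -> agree_before i j Y Z ->
  j1 = j.+1 :> nat ->
  horner_sqmx Z f i j1 = horner_sqmx Y f i j1 + f`_2 * ((Z i j - Y i j) * Y j j1).
Proof.
move=> f0 f1 upY upZ agr j1E; apply/eqP; rewrite -subr_eq0 opprD addrA subr_eq0.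
rewrite /horner_sqmx !summxE -sumrB; apply/eqP.
have termE (s : nat) : (f`_s *: Z ^+ s) i j1 - (f`_s *: Y ^+ s) i j1 =
    (s == 2)%:R * (f`_2 * ((Z i j - Y i j) * Y j j1)).
  rewrite !mxE -mulrBr; case: s => [|[|s]]; rewrite ?f0 ?f1 ?mul0r //.
  rewrite (expmx_agree_before upY upZ agr) // !eqSS.
  by case: eqP => [->|_]; rewrite ?mul0r ?mulr0 // !mul1r.
under eq_bigr do rewrite termE.
case: (ltnP 2 (size f)) => [lt2|le2].
  rewrite (bigD1 (Ordinal lt2)) //= mul1r big1 ?addr0 // => s.
  by rewrite -val_eqE /= => /negPf ->; rewrite mul0r.
by rewrite nth_default // !mul0r big1 // => s _; rewrite mulr0.
Qed.

Lemma horner_sqmx_low_entry m f (Z : 'M[F]_m) (i c : 'I_m) :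
  f`_0 = 0 -> f`_1 = 0 -> strictly_upper Z -> (c <= i.+1)%N ->
  horner_sqmx Z f i c = 0.
Proof.
move=> f0 f1 upZ ci; rewrite summxE big1 // => -[[|[|s]] /= _] _.
- by rewrite f0 scale0r mxE.
- by rewrite f1 scale0r mxE.
rewrite mxE strictly_upper_expmx ?mulr0 //.
by rewrite (leq_ltn_trans ci) // !addnS !ltnS leq_addr.
Qed.

Lemma horner_sqmx_second_diagonal m f (Z : 'M[F]_m) (i i1 i2 : 'I_m) :
  f`_0 = 0 -> f`_1 = 0 -> strictly_upper Z ->
  i1 = i.+1 :> nat -> i2 = i1.+1 :> nat ->
  horner_sqmx Z f i i2 = f`_2 * (Z i i1 * Z i1 i2).
Proof.
move=> f0 f1 upZ i1E i2E.
(* Z is compared with the matrix Y obtained by clearing its row i: the entry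
   (i, i2) of f(Y) vanishes. *)
pose Y := \matrix_(a, b) if a == i then 0 else Z a b.
have upY : strictly_upper Y by move=> a b ba; rewrite mxE upZ //; case: ifP.
have agr : agree_before i i1 Y Z.
  move=> a b _; rewrite mxE; case: eqP => // ->; rewrite ltnn /= => bi1.
  by rewrite upZ // -ltnS -i1E.
have rowY s : (0 < s)%N -> (Y ^+ s) i i2 = 0.
  case: s => // s _; rewrite exprS -mulmxE mxE big1 // => l _.
  by rewrite mxE eqxx mul0r.
have i1i : (i1 == i) = false by rewrite -val_eqE /= i1E gtn_eqF.
rewrite (horner_sqmx_agree_before f0 f1 upY upZ agr i2E) ![Y _ _]mxE eqxx i1i subr0.
rewrite summxE big1 ?add0r // => -[[|s] /= _] _; first by rewrite f0 scale0r mxE.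
by rewrite mxE rowY ?mulr0.
Qed.

(** For strictly upper triangular Z, the coefficients of the equation on and below
    the first superdiagonal are trivial. *)
Lemma nilp_jordan_equation m f (Z : 'M[F]_m) :
  f`_0 = 0 -> f`_1 = 0 -> strictly_upper Z ->
  Z *m nilp_jordan F m - nilp_jordan F m *m Z = horner_sqmx Z f <->
  (forall i j i1 j1 : 'I_m, (i < j)%N -> i1 = i.+1 :> nat -> j1 = j.+1 :> nat ->
     Z i j - Z i1 j1 = horner_sqmx Z f i j1).
Proof.
move=> f0 f1 upZ; split => [eqZ i j i1 j1 ij i1E j1E|eqZ].
  rewrite -eqZ [RHS]mxE [X in _ = _ + X]mxE.
  by rewrite (mulmx_nilp_jordan _ _ j1E) (nilp_jordan_mulmx _ _ i1E).
apply/matrixP => i c; rewrite [LHS]mxE [X in _ + X = _]mxE.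
case: (leqP c i.+1) => [ci|ic].
  rewrite horner_sqmx_low_entry //.
  have -> : (nilp_jordan F m *m Z) i c = 0.
    case: (ltnP i.+1 m) => [lti|lei].
      rewrite (nilp_jordan_mulmx _ _ (erefl : Ordinal lti = i.+1 :> nat)).
      by rewrite upZ.
    by rewrite nilp_jordan_mulmx_last //; apply/eqP; rewrite eqn_leq ltn_ord.
  rewrite subr0; case: (posnP c) => [c0|c_gt0]; first by rewrite mulmx_nilp_jordan0.
  have ltc : (c.-1 < m)%N by rewrite prednK // ltnW.
  rewrite (@mulmx_nilp_jordan _ _ _ _ _ (Ordinal ltc)) /= ?prednK //.
  by rewrite upZ //= -ltnS prednK.
have c_gt0 : (0 < c)%N by exact: leq_ltn_trans ic.
have ltc : (c.-1 < m)%N by rewrite prednK // ltnW.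
have lti : (i.+1 < m)%N by exact: ltn_trans (ltn_ord c).
have cE : c = (Ordinal ltc).+1 :> nat by rewrite /= prednK.
rewrite (mulmx_nilp_jordan _ _ cE).
rewrite (nilp_jordan_mulmx _ _ (erefl : Ordinal lti = i.+1 :> nat)).
by apply: eqZ => //=; rewrite -ltnS prednK.
Qed.

End Dependency.

(** * The equation of degree one for an entry *)

Section Coefficients.
Context {F : fieldType}.

Lemma coefXnM_low p (g : {poly F}) s : (s < p)%N -> ('X^p * g)`_s = 0.
Proof. by move=> sp; rewrite coefXnM sp. Qed.

(** [entry_solution] solves the coefficient (i, j+1) of the equation for the entry
    (i, j), provided that its denominator does not vanish. *)
Lemma entry_solutionP p (g : {poly F}) m (Y Z : 'M[F]_m) (i j i1 j1 : 'I_m) :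
  (1 < p)%N -> strictly_upper Y -> strictly_upper Z -> agree_before i j Y Z ->
  Y i j = 0 -> (i < j)%N -> i1 = i.+1 :> nat -> j1 = j.+1 :> nat ->
  1 - kappa p g * Z j j1 != 0 ->
  entry_solution p g Y i j = Z i j <->
  Z i j - Z i1 j1 = horner_sqmx Z ('X^p * g) i j1.
Proof.
move=> p_gt1 upY upZ agr Yij ij i1E j1E den0.
have f0 := @coefXnM_low p g 0 (ltnW p_gt1); have f1 := @coefXnM_low p g 1 p_gt1.
rewrite (horner_sqmx_agree_before f0 f1 upY upZ agr j1E) Yij subr0.
have YE : Y j j1 = Z j j1 by apply: agr; rewrite ?j1E ?ij.
have Y1E : Y i1 j1 = Z i1 j1 by apply: agr; rewrite ?j1E ?i1E ?ltnSn.
rewrite /entry_solution !(mulmx_nilp_jordan_tr _ _ j1E) (nilp_jordan_mulmx _ _ i1E).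
rewrite expmx_mul_horner_sqmx Y1E YE -/(kappa p g).
set h := horner_sqmx _ _ _ _; move: (kappa p g) (Z j j1) den0 => ka z den0.
split => [/(canRL (divfK den0))|].
  by move=> /(canRL (addKr _)) ->; ring.
move=> /(canRL (subrK _)) zE; apply: (canLR (mulfK den0)).
by rewrite mulrBr mulr1 {1}zE; ring.
Qed.

Lemma last_colE m (Z : 'M[F]_m) (r : 'I_m.-1) (a b : 'I_m) :
  a = r :> nat -> b.+1 = m -> last_col Z r 0 = Z a b.
Proof.
case: m Z r a b => [|m] Z r a b; first by case: a.
move=> ar [bm]; rewrite mxE; congr (Z _ _); apply: val_inj => /=; by [rewrite ar|].
Qed.

Lemma last_col_mxE m (u : 'cV[F]_m.-1) (r : 'I_m.-1) (a b : 'I_m) :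
  a = r :> nat -> b.+1 = m -> last_col_mx u a b = u r 0.
Proof.
move=> ar bm; rewrite mxE bm eqxx; case: insubP => [r' _ r'E|] /=.
  by congr (u _ _); apply: val_inj; rewrite r'E.
by rewrite ar ltn_ord.
Qed.

Lemma last_col_mx_bottom m (u : 'cV[F]_m.-1) (a b : 'I_m) :
  (b <= a)%N -> last_col_mx u a b = 0.
Proof.
rewrite mxE; case: eqP => // bm ba; case: insubP => //= r lt_am _.
case: m u a b bm ba r lt_am => [|m] u a b; first by case: a.
by move=> [bm] + r /= am; rewrite bm leqNgt am.
Qed.

Lemma last_col_mx_off m (u : 'cV[F]_m.-1) (a b : 'I_m) :
  (b.+1 < m)%N -> last_col_mx u a b = 0.
Proof. by move=> bm; rewrite mxE ltn_eqF. Qed.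

End Coefficients.

(** * The order of resolution *)

Section SolvingOrder.

(** The strict order along which the entries are solved: by superdiagonal, then
    from bottom to top. *)
Definition solved_before m (x y : 'I_m * 'I_m) : bool :=
  (x.2 - x.1 < y.2 - y.1)%N || ((x.2 - x.1 == y.2 - y.1)%N && (y.1 < x.1)%N).

(** The order in which all the positions are listed before they are sorted by
    superdiagonal: rows from bottom to top, each one from left to right. *)
Let row_major m (x y : 'I_m * 'I_m) : bool :=
  (y.1 < x.1)%N || ((x.1 == y.1) && (x.2 < y.2)%N).

Let pairwise_row_major m :
  pairwise (@row_major m) [seq (i, j) | i <- rev (enum 'I_m), j <- enum 'I_m].
Proof.
have enum_lt : pairwise (fun a b : 'I_m => (a < b)%N) (enum 'I_m).
  rewrite -(pairwise_map val ltn) val_enum_ord -sorted_pairwise ?iota_ltn_sorted //.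
  exact: ltn_trans.
have rev_gt : pairwise (fun a b : 'I_m => (b < a)%N) (rev (enum 'I_m)).
  rewrite -(pairwise_map val (fun a b => ltn b a)) map_rev val_enum_ord.
  rewrite -sorted_pairwise; last by move=> a b c /= ba ac; apply: ltn_trans ac ba.
  by rewrite rev_sorted iota_ltn_sorted.
elim: (rev _) rev_gt => //= i s IH /andP[/allP ilt lts].
rewrite pairwise_cat IH // andbT; apply/andP; split; last first.
  rewrite pairwise_map; apply: sub_pairwise enum_lt => a b ab /=.
  by rewrite /row_major /= eqxx ab orbT.
apply/allrelP => x y /mapP[j _ ->] /allpairsP[[i' j'] [/= /ilt lti _ ->]].
by rewrite /row_major /= lti.
Qed.

Lemma mem_solving_order m (i j : 'I_m) :
  ((i, j) \in solving_order m) = (i < j)%N && (j.+1 < m)%N.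
Proof.
apply/flatten_mapP/andP => [[d]|[ij jm]].
  rewrite mem_iota mem_filter => /andP[d_gt0 _] /andP[/andP[/eqP /= jE jm] _].
  by split=> //; rewrite jE -addn1 leq_add2l.
exists (j - i)%N.
  by rewrite mem_iota subn_gt0 ij; lia.
rewrite mem_filter /= subnKC ?eqxx ?jm 1?ltnW //=; apply/allpairsP.
by exists (i, j); rewrite mem_rev !mem_enum.
Qed.

Lemma pairwise_solving_order m : pairwise (@solved_before m) (solving_order m).
Proof.
rewrite /solving_order; elim: (m - 2)%N {1}1%N => //= e IH d.
rewrite pairwise_cat IH andbT; apply/andP; split; last first.
  apply: (@sub_in_pairwise _ [pred x : 'I_m * 'I_m | x.2 == x.1 + d :> nat]%N
            (@row_major m)).
  - move=> [a b] [a' b'] /= /eqP bE /eqP b'E; rewrite /row_major /solved_before /=.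
    rewrite bE b'E !addKn eqxx ltnn /= => /orP[//|/andP[/eqP-> ]].
    by rewrite ltnn.
  - by apply/allP => x; rewrite mem_filter => /andP[/andP[]].
  - exact/pairwise_filter/pairwise_row_major.
apply/allrelP => x y; rewrite mem_filter => /andP[/andP[/eqP xE _] _].
move=> /flatten_mapP[d']; rewrite mem_iota mem_filter => /andP[dd' _].
by move=> /andP[/andP[/eqP yE _] _]; rewrite /solved_before xE yE !addKn dd'.
Qed.

Lemma solved_before_irr m : irreflexive (@solved_before m).
Proof. by move=> x; rewrite /solved_before !ltnn andbF. Qed.

Lemma solving_order_uniq m : uniq (solving_order m).
Proof. exact: pairwise_uniq (@solved_before_irr m) (pairwise_solving_order m). Qed.

Lemma solved_before_prefix m (s1 s2 : seq ('I_m * 'I_m)) x y :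
  solving_order m = s1 ++ x :: s2 -> y \in solving_order m ->
  solved_before y x -> y \in s1.
Proof.
move=> sE; rewrite sE mem_cat => /orP[//|]; rewrite inE => ys yx.
have := pairwise_solving_order m; rewrite sE pairwise_cat /=.
case/and4P=> _ _ /allP xs2 _.
case/orP: ys => [/eqP yx'|/xs2 xy]; first by rewrite yx' solved_before_irr in yx.
by move: xy yx; rewrite /solved_before; lia.
Qed.

End SolvingOrder.

(** * The nilpotent solutions for one Jordan block *)

Section BlockSolution.
Context {F : fieldType}.
Variables (p : nat) (g : {poly F}).
Hypothesis p_gt1 : (1 < p)%N.

Local Notation f := ('X^p * g).
Local Notation J m := (nilp_jordan F m).
Local Notation ka := (kappa p g).
Local Notation fill :=
  (foldl (fun Y ij => Y + entry_solution p g Y ij.1 ij.2 *: delta_mx ij.1 ij.2)).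

Let f0 : f`_0 = 0. Proof. exact/coefXnM_low/ltnW. Qed.
Let f1 : f`_1 = 0. Proof. exact/coefXnM_low. Qed.

(** Solving the positions of [s] leaves the other ones unchanged. *)
Lemma fill_notin m (Y : 'M[F]_m) s a b : (a, b) \notin s -> fill Y s a b = Y a b.
Proof.
elim: s Y => //= -[i j] s IH Y; rewrite inE negb_or => /andP[abij abs].
rewrite IH // !mxE; move: abij; rewrite xpair_eqE => /negPf -> /=.
by rewrite mulr0 addr0.
Qed.

Lemma fill_strictly_upper m (Y : 'M[F]_m) s :
  strictly_upper Y -> {subset s <= solving_order m} -> strictly_upper (fill Y s).
Proof.
move=> upY sub a b ba; rewrite fill_notin ?upY //; apply/negP => /sub.
by rewrite mem_solving_order ltnNge ba.
Qed.

(** The first superdiagonal satisfies a Riccati recursion, which is solved from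
    its bottom entry [c] upwards: the entry r places above is c / (1 - r k c). *)
Lemma superdiagonal_closed_form m (Z : 'M[F]_m) (k c : F) :
  (forall a b : 'I_m, b = a.+1 :> nat -> b.+1 = m -> Z a b = c) ->
  (forall j j1 j2 : 'I_m, j1 = j.+1 :> nat -> j2 = j1.+1 :> nat ->
     1 - k * Z j1 j2 != 0 -> Z j j1 * (1 - k * Z j1 j2) = Z j1 j2) ->
  forall r (j j1 : 'I_m), j1 = j.+1 :> nat -> (j + r.+2)%N = m ->
    (forall l, (1 <= l <= r)%N -> 1 - l%:R * k * c != 0) ->
  (1 - r%:R * k * c) * Z j j1 = c.
Proof.
move=> Zc rec; elim=> [|r IH] j j1 j1E jr adm.
  by rewrite !mul0r subr0 mul1r Zc //; lia.
have lt2 : (j1.+1 < m)%N by lia.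
pose j2 := Ordinal lt2.
have jr' : (j1 + r.+2)%N = m by lia.
have IHj : (1 - r%:R * k * c) * Z j1 j2 = c.
  by apply: IH => // l /andP[l_gt0 lr]; rewrite adm // l_gt0 ltnW.
have step : (1 - r%:R * k * c) * (1 - k * Z j1 j2) = 1 - r.+1%:R * k * c.
  rewrite mulrBr mulrCA IHj -addn1 natrD; ring.
have den0 : 1 - k * Z j1 j2 != 0.
  have := adm r.+1; rewrite leqnn -step mulf_eq0 negb_or => /(_ isT).
  by case/andP.
by rewrite -step -mulrA [_ * Z j j1]mulrC rec.
Qed.

(** Admissibility of the last column is what keeps the denominators of the whole
    calculation nonzero. *)
Lemma superdiagonal_denominator m (Z : 'M[F]_m) (j j1 : 'I_m) :
  (forall j j1 j2 : 'I_m, j1 = j.+1 :> nat -> j2 = j1.+1 :> nat ->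
     1 - ka * Z j1 j2 != 0 -> Z j j1 * (1 - ka * Z j1 j2) = Z j1 j2) ->
  admissible p g (last_col Z) -> (0 < j)%N -> j1 = j.+1 :> nat ->
  1 - ka * Z j j1 != 0.
Proof.
move=> rec adm j_gt0 j1E.
have m_ge : (j.+1 < m)%N by rewrite -j1E.
have ltr : (m - 2 < m.-1)%N by lia.
pose r0 := Ordinal ltr; pose c := last_col Z r0 0.
have adm' l : (1 <= l <= m - 2)%N -> 1 - l%:R * ka * c != 0.
  by apply: adm; rewrite /=; lia.
have Zc (a b : 'I_m) : b = a.+1 :> nat -> b.+1 = m -> Z a b = c.
  by move=> bE bm; rewrite /c (@last_colE _ _ _ r0 a b) //=; lia.
pose r := (m - j.+2)%N.
have cf : (1 - r%:R * ka * c) * Z j j1 = c.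
  apply: (superdiagonal_closed_form Zc rec) => //; first by rewrite /r; lia.
  by move=> l lr; apply: adm'; rewrite /r in lr; lia.
(* As Z j j1 = c / (1 - r kappa c), the denominator is the quotient of
   1 - (r + 1) kappa c by 1 - r kappa c. *)
have : 1 - r.+1%:R * ka * c != 0 by apply: adm'; rewrite /r; lia.
apply: contraNneq => den0.
have <- : (1 - r%:R * ka * c) * (1 - ka * Z j j1) = 1 - r.+1%:R * ka * c.
  rewrite mulrBr mulrCA cf -addn1 natrD; ring.
by rewrite den0 mulr0.
Qed.

Lemma superdiagonal_recursion m (Z : 'M[F]_m) (j j1 j2 : 'I_m) :
  strictly_upper Z -> j1 = j.+1 :> nat -> j2 = j1.+1 :> nat ->
  Z j j1 - Z j1 j2 = horner_sqmx Z f j j2 ->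
  Z j j1 * (1 - ka * Z j1 j2) = Z j1 j2.
Proof.
move=> upZ j1E j2E; rewrite (horner_sqmx_second_diagonal f0 f1 upZ j1E j2E).
by move=> /(canRL (subrK _)) zE; rewrite mulrBr mulr1 {1}zE /kappa; ring.
Qed.

Section Uniqueness.
Variables (m : nat) (Z : 'M[F]_m).
Hypothesis upZ : strictly_upper Z.
Hypothesis eqZ : Z *m J m - J m *m Z = horner_sqmx Z f.

Let eqE : forall i j i1 j1 : 'I_m, (i < j)%N -> i1 = i.+1 :> nat ->
  j1 = j.+1 :> nat -> Z i j - Z i1 j1 = horner_sqmx Z f i j1.
Proof. by apply/nilp_jordan_equation. Qed.

Let rec (j j1 j2 : 'I_m) : j1 = j.+1 :> nat -> j2 = j1.+1 :> nat ->
  Z j j1 * (1 - ka * Z j1 j2) = Z j1 j2.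
Proof.
move=> j1E j2E; apply: superdiagonal_recursion => //.
by apply: eqE => //; rewrite j1E.
Qed.

(** Conversely, for a solution, a vanishing denominator would force the entry that
    it contains to vanish too. *)
Lemma solution_admissible : admissible p g (last_col Z).
Proof.
move=> r0 r0E; set c := last_col Z r0 0.
have Zc (a b : 'I_m) : b = a.+1 :> nat -> b.+1 = m -> Z a b = c.
  by move=> bE bm; rewrite /c (@last_colE _ _ _ r0 a b) //; lia.
elim/ltn_ind => -[|l] // IH /andP[_ lm].
have adm l' : (1 <= l' <= l)%N -> 1 - l'%:R * ka * c != 0.
  by move=> /andP[l'_gt0 l'l]; apply: IH => //; lia.
have ltj : (m - l.+3 < m)%N by lia.
have ltj1 : ((m - l.+3).+1 < m)%N by lia.
have ltj2 : ((m - l.+3).+2 < m)%N by lia.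
have cf : (1 - l%:R * ka * c) * Z (Ordinal ltj1) (Ordinal ltj2) = c.
  apply: (superdiagonal_closed_form Zc) => //=; last by lia.
  by move=> *; apply: rec.
have rj := @rec (Ordinal ltj) (Ordinal ltj1) (Ordinal ltj2) erefl erefl.
have -> : 1 - l.+1%:R * ka * c =
    (1 - l%:R * ka * c) * (1 - ka * Z (Ordinal ltj1) (Ordinal ltj2)).
  rewrite mulrBr mulrCA cf -addn1 natrD; ring.
rewrite mulf_neq0 //.
  by case: l adm {IH lm ltj ltj1 ltj2 cf rj} => [|l] adm;
     [rewrite !mul0r subr0 oner_eq0 | rewrite adm //= leqnn].
apply/eqP => den0; have z0 := rj; rewrite den0 mulr0 in z0; move/eqP: den0.
by rewrite -z0 mulr0 subr0 oner_eq0.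
Qed.

(** After each prefix of the solving order, the calculation has found the entries
    of the solution in that prefix. *)
Lemma solution_unique : Z = block_solution p g (last_col Z).
Proof.
have prefix s1 s2 : solving_order m = s1 ++ s2 ->
    fill (last_col_mx (last_col Z)) s1 =
    \matrix_(a, b) if ((a, b) \in s1) || (b.+1 == m) then Z a b else 0.
  elim/last_ind: s1 s2 => [|s1 [i j] IH] s2 sE.
    apply/matrixP => a b; rewrite [RHS]mxE /=.
    case: eqP => [bm|/eqP bm]; last first.
      by rewrite last_col_mx_off // ltn_neqAle bm ltn_ord.
    case: (leqP b a) => [ba|ab]; first by rewrite last_col_mx_bottom // upZ.
    have lta : (a < m.-1)%N by lia.
    by rewrite (@last_col_mxE _ _ _ (Ordinal lta)) // (@last_colE _ _ _ _ a b).
  rewrite cat_rcons in sE; rewrite foldl_rcons /= (IH _ sE).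
  set Y := \matrix_(a, b) _.
  have ijin : (i, j) \in solving_order m by rewrite sE mem_cat mem_head orbT.
  have := ijin; rewrite mem_solving_order => /andP[ij jm].
  have lti : (i.+1 < m)%N by lia.
  have ijs1 : (i, j) \notin s1.
    have := solving_order_uniq m; rewrite sE cat_uniq.
    case/and3P=> _ /hasPn/(_ (i, j)); by rewrite mem_head => /(_ isT).
  have upY : strictly_upper Y by move=> a b ba; rewrite mxE upZ //; case: ifP.
  have Yij : Y i j = 0 by rewrite mxE (negPf ijs1) ltn_eqF.
  have agr : agree_before i j Y Z.
    move=> a b bj abij; rewrite mxE; case: ifP => // /negbT; rewrite negb_or.
    case: (leqP b a) => [ba|ab]; first by rewrite upZ.
    case/andP=> abs1 bm; case/negP: abs1; apply: (solved_before_prefix sE).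
      by rewrite mem_solving_order ab /= ltn_neqAle bm ltn_ord.
    case/orP: abij => [ia|/andP[/eqP-> bj']]; rewrite /solved_before /=; lia.
  have den := superdiagonal_denominator (fun j j1 j2 e e1 _ => rec e e1)
    solution_admissible (leq_ltn_trans (leq0n i) ij)
    (erefl : Ordinal jm = j.+1 :> nat).
  have -> : entry_solution p g Y i j = Z i j.
    apply/(@entry_solutionP _ p g m Y Z i j (Ordinal lti) (Ordinal jm)) => //.
    exact: eqE.
  apply/matrixP => a b; rewrite !mxE mem_rcons inE xpair_eqE.
  case: (eqVneq a i) => [->|_]; case: (eqVneq b j) => [->|_];
    rewrite /= ?mulr1 ?mulr0 ?addr0 //.
  by rewrite (negPf ijs1) ltn_eqF // add0r.
have := prefix (solving_order m) [::]; rewrite cats0 => /(_ erefl).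
rewrite /block_solution => ->; apply/matrixP => a b; rewrite mxE.
rewrite mem_solving_order; case: ifP => // /negbT; rewrite negb_or negb_and -!leqNgt.
case/andP=> /orP[ba _|mb bm]; first by rewrite upZ.
by have := ltn_ord b; lia.
Qed.

End Uniqueness.

Section Existence.
Variables (m : nat) (u : 'cV[F]_m.-1).
Hypothesis adm_u : admissible p g u.
Let W := block_solution p g u.

Let upW : strictly_upper W.
Proof. by apply: fill_strictly_upper => // a b; apply: last_col_mx_bottom. Qed.

Lemma last_col_block_solution : last_col W = u.
Proof.
apply/matrixP => r c; rewrite ord1.
have ltr : (r < m)%N by have := ltn_ord r; lia.
have ltm : (m.-1 < m)%N by have := ltn_ord r; lia.
have bm : (Ordinal ltm).+1 = m by rewrite /= prednK //; lia.
rewrite (@last_colE _ _ _ _ (Ordinal ltr) (Ordinal ltm)) //.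
rewrite /W /block_solution fill_notin ?(@last_col_mxE _ _ _ r) //.
by rewrite mem_solving_order bm ltnn andbF.
Qed.

(* The entry (i, j) of the final matrix is the one computed at its turn from a
   matrix that agrees with the final one on all the entries it depends on. *)
Let eqW (i j i1 j1 : 'I_m) : (i < j)%N -> i1 = i.+1 :> nat -> j1 = j.+1 :> nat ->
  1 - ka * W j j1 != 0 -> W i j - W i1 j1 = horner_sqmx W f i j1.
Proof.
move=> ij i1E j1E den.
have ijin : (i, j) \in solving_order m by rewrite mem_solving_order ij -j1E /=.
case/splitPr sE: {1}(solving_order m) / ijin => [s1 s2].
pose Y := fill (last_col_mx u) s1.
have uniqs := solving_order_uniq m; rewrite sE cat_uniq /= in uniqs.
case/and4P: uniqs => _; rewrite negb_or => /andP[ijs1 _] ijs2 _.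
have WE : W = fill (Y + entry_solution p g Y i j *: delta_mx i j) s2.
  by rewrite /W /block_solution sE foldl_cat.
have subs1 : {subset s1 <= solving_order m} by move=> x xs; rewrite sE mem_cat xs.
have upY : strictly_upper Y.
  by apply: fill_strictly_upper => // a b; apply: last_col_mx_bottom.
have Yij : Y i j = 0 by rewrite fill_notin // last_col_mx_off // -j1E.
have YW a b : (a, b) \notin (i, j) :: s2 -> Y a b = W a b.
  rewrite inE negb_or xpair_eqE => /andP[/negPf nab abs2].
  rewrite WE [RHS](fill_notin _ abs2) [RHS]mxE [X in _ = _ + X]mxE mxE nab.
  by rewrite mulr0 addr0.
have agr : agree_before i j Y W.
  move=> a b bj abij; case: (leqP b a) => [ba|ab]; first by rewrite upW ?upY.
  apply: YW; apply/negP => abin.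
  have abo : (a, b) \in solving_order m by rewrite sE mem_cat abin orbT.
  have abs1 : (a, b) \in s1.
    apply: (solved_before_prefix sE) => //; have := abo; rewrite mem_solving_order.
    case/orP: abij => [ia|/andP[/eqP-> bj']]; rewrite /solved_before /=; lia.
  have := solving_order_uniq m; rewrite sE cat_uniq => /and3P[_ /hasPn /(_ _ abin)].
  by rewrite abs1.
apply/(entry_solutionP p_gt1 upY upW agr Yij ij i1E j1E den).
by rewrite WE (fill_notin _ ijs2) !mxE !eqxx mulr1 Yij add0r.
Qed.

Lemma block_solution_solution : nilpotent_solution p g (J m) W.
Proof.
split; first exact: strictly_upper_nilpotent.
rewrite expmx_mul_horner_sqmx; apply/(nilp_jordan_equation f0 f1 upW).
move=> i j i1 j1 ij i1E j1E; apply: eqW => //.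
apply: superdiagonal_denominator => //; last exact: leq_ltn_trans ij.
  move=> a a1 a2 a1E a2E den; apply: superdiagonal_recursion => //.
  by apply: eqW => //; rewrite a1E.
by rewrite last_col_block_solution.
Qed.

End Existence.

Lemma nilpotent_block_solution m (Z : 'M[F]_m) : nilpotent_solution p g (J m) Z ->
  [/\ strictly_upper Z, admissible p g (last_col Z)
    & Z = block_solution p g (last_col Z)].
Proof.
move=> solZ; have upZ := nilpotent_solution_strictly_upper (ltnW p_gt1) solZ.
case: solZ => _; rewrite expmx_mul_horner_sqmx => eqZ.
by split; [|exact: solution_admissible|exact: solution_unique].
Qed.

End BlockSolution.

(** * Block diagonal matrices *)

Section BlockDiagonal.
Context {F : fieldType} {n k : nat} {al : 'I_k -> nat}.
Variable en : (\sum_(i < k) al i)%N = n.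
Implicit Types (B C : forall i : 'I_k, 'M[F]_(al i)).

Lemma block_diag_inj B C : block_diag en B = block_diag en C -> forall i, B i = C i.
Proof.
by rewrite /block_diag; case: _ / en; rewrite !castmx_id => /eq_mxdiagP.
Qed.

Lemma block_diagM B C :
  block_diag en B *m block_diag en C = block_diag en (fun i => B i *m C i).
Proof.
rewrite /block_diag; case: _ / en; rewrite !castmx_id {2}/mxdiag mul_mxdiag_mxblock.
apply: eq_mxblock => i j; case: eqVneq => [<-|_]; last by rewrite mulmx0.
by rewrite !conform_mx_id.
Qed.

Lemma block_diag_scalar a : block_diag en (fun i => (a%:M : 'M[F]_(al i))) = a%:M.
Proof. by rewrite /block_diag; case: _ / en; rewrite castmx_id mxdiagZ. Qed.

Lemma block_diagZ a B : block_diag en (fun i => a *: B i) = a *: block_diag en B.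
Proof.
rewrite -mul_scalar_mx -block_diag_scalar block_diagM /block_diag.
by congr castmx; apply: eq_mxdiag => i; rewrite mul_scalar_mx.
Qed.

Lemma block_diagB B C :
  block_diag en (fun i => B i - C i) = block_diag en B - block_diag en C.
Proof. by rewrite /block_diag; case: _ / en; rewrite !castmx_id mxdiagB. Qed.

Lemma block_diag_sum (I : finType) (B : I -> forall i : 'I_k, 'M[F]_(al i)) :
  block_diag en (fun i => \sum_l B l i) = \sum_l block_diag en (B l).
Proof.
rewrite /block_diag; case: _ / en; rewrite castmx_id mxdiag_sum.
by apply: eq_bigr => l _; rewrite castmx_id.
Qed.

Lemma eq_block_diag B C : (forall i, B i = C i) -> block_diag en B = block_diag en C.
Proof. by move=> BC; congr castmx; apply: eq_mxdiag. Qed.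

Lemma block_diagX B e : block_diag en B ^+ e = block_diag en (fun i => B i ^+ e).
Proof.
elim: e => [|e IH].
  by rewrite expr0 -[1]/(1%:M) -block_diag_scalar; apply: eq_block_diag => i.
by rewrite exprS IH -mulmxE block_diagM; apply: eq_block_diag => i; rewrite exprS.
Qed.

Lemma horner_block_diag B q :
  horner_sqmx (block_diag en B) q = block_diag en (fun i => horner_sqmx (B i) q).
Proof.
rewrite /horner_sqmx (block_diag_sum (fun (l : 'I_(size q)) i => q`_l *: B i ^+ l)).
apply: eq_bigr => i _.
by rewrite block_diagZ block_diagX.
Qed.

Lemma block_diag0 : block_diag en (fun i => (0 : 'M[F]_(al i))) = 0.
Proof. by rewrite /block_diag; case: _ / en; rewrite castmx_id mxdiag0. Qed.

Lemma block_diag_nilpotent B :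
  nilpotent_mx (block_diag en B) <-> forall i, nilpotent_mx (B i).
Proof.
split=> [[N] + i|/fin_all_exists[N BN0]].
  rewrite block_diagX -block_diag0 => /block_diag_inj/(_ i) BN0.
  by exists N.
exists (\max_i N i)%N; rewrite block_diagX -[RHS]block_diag0.
apply: eq_block_diag => i; have le_i : (N i <= \max_i N i)%N by exact: leq_bigmax.
by rewrite -(subnKC le_i) exprD BN0 mul0r.
Qed.

Lemma block_diag_nilpotent_solution p (g : {poly F}) B C :
  nilpotent_solution p g (block_diag en C) (block_diag en B) <->
  forall i, nilpotent_solution p g (C i) (B i).
Proof.
rewrite /nilpotent_solution !block_diagM -block_diagB block_diagX horner_block_diag.
rewrite block_diagM; split=> [[nilB /block_diag_inj eqB] i|sol].
  by split; [move/block_diag_nilpotent: nilB; apply|exact: eqB].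
split; first by apply/block_diag_nilpotent => i; case: (sol i).
by apply: eq_block_diag => i; case: (sol i).
Qed.

End BlockDiagonal.

(** * Change of basis, translation, and the Sylvester equation *)

Section Conjugation.
Context {F : fieldType}.

Lemma nilpotent_solution_conj p (g : {poly F}) n (A A' X X' P : 'M[F]_n) :
  P \in unitmx -> A *m P = P *m A' -> X *m P = P *m X' ->
  nilpotent_solution p g A X <-> nilpotent_solution p g A' X'.
Proof.
move=> uP AP XP; rewrite /nilpotent_solution !expmx_mul_horner_sqmx.
have fP := horner_sqmx_intertwine ('X^p * g) XP.
have cP : (X *m A - A *m X) *m P = P *m (X' *m A' - A' *m X').
  by rewrite mulmxBl mulmxBr -!mulmxA AP XP !mulmxA AP XP.
have NP e : X ^+ e = 0 <-> X' ^+ e = 0.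
  have XeP := expmx_intertwine e XP; split=> X0.
    by apply: (can_inj (mulKmx uP)); rewrite -XeP X0 mul0mx mulmx0.
  by apply: (can_inj (mulmxK uP)); rewrite XeP X0 mul0mx mulmx0.
split=> -[[N XN0] eqX]; split; try by exists N; apply/NP.
  by apply: (can_inj (mulKmx uP)); rewrite -fP -cP eqX.
by apply: (can_inj (mulmxK uP)); rewrite fP cP eqX.
Qed.

Lemma nilpotent_solution_shift p (g : {poly F}) m a (A X : 'M[F]_m) :
  nilpotent_solution p g (a%:M + A) X <-> nilpotent_solution p g A X.
Proof.
rewrite /nilpotent_solution mulmxDr mulmxDl scalar_mxC opprD addrACA subrr add0r.
by [].
Qed.

Lemma jordan_block_unit m (a : F) : a != 0 -> jordan_block m a \in unitmx.
Proof.
move=> an0; rewrite unitmxE -det_tr det_trig.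
  by rewrite unitfE prodf_seq_neq0; apply/allP => i _ /=;
     rewrite !mxE eqxx ltn_eqF // addr0.
apply/is_trig_mxP => i j ij; rewrite !mxE.
by rewrite -val_eqE gtn_eqF // mulr0n add0r ltn_eqF // ltnS ltnW.
Qed.

(** Uniqueness in the Sylvester equation of two Jordan blocks. *)
Lemma jordan_block_sylvester m1 m2 (a b : F) (Z : 'M[F]_(m1, m2)) : a != b ->
  jordan_block m1 a *m Z - Z *m jordan_block m2 b = 0 -> Z = 0.
Proof.
move=> ab /eqP; rewrite subr_eq0 => /eqP eqZ.
(* After subtracting a, one side is nilpotent and the other invertible. *)
have {eqZ} eqZ : nilp_jordan F m1 *m Z = Z *m jordan_block m2 (b - a).
  move: eqZ; rewrite /jordan_block mulmxDl !mulmxDr => /(canRL (addKr _)) ->.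
  by rewrite raddfB /= mulmxBr -!scalar_mxC addrA [- _ + _]addrC.
have uU : jordan_block m2 (b - a) \in unitmx.
  by apply: jordan_block_unit; rewrite subr_eq0 eq_sym.
have := expmx_intertwine m1 eqZ; rewrite expmx_nilp_jordan0 mul0mx.
move/esym; elim: (X in _ ^+ X) => [|e IH]; first by rewrite expr0 mulmx1.
by rewrite exprSr -mulmxE mulmxA => /(canRL (mulmxK uU)); rewrite mul0mx.
Qed.

End Conjugation.

(** * Nilpotent solutions are block diagonal in a Jordan basis *)

Section IteratedCommutator.
Context {F : fieldType}.

Lemma commutator_horner_mx n (A X : 'M[F]_n.+1) f q :
  X *m A - A *m X = horner_mx X f ->
  A *m horner_mx X q - horner_mx X q *m A = - horner_mx X (q^`() * f).
Proof.
move=> XA; elim/poly_ind: q => [|q c IH].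
  by rewrite deriv0 mul0r !rmorph0 mulmx0 mul0mx subrr oppr0.
have -> : horner_mx X (q * 'X + c%:P) = horner_mx X q *m X + c%:M.
  by rewrite rmorphD rmorphM /= horner_mx_X horner_mx_C.
have -> : horner_mx X ((q * 'X + c%:P)^`() * f) =
    horner_mx X (q^`() * f) *m X + horner_mx X q *m horner_mx X f.
  rewrite derivD derivM derivX derivC mulr1 addr0 mulrDl mulrAC.
  by rewrite rmorphD !(rmorphM _ _ 'X) /= !rmorphM /= horner_mx_X !mulmxE.
rewrite -[horner_mx X (q^`() * f)]opprK -IH -XA opprB mulmxDr mulmxDl scalar_mxC.
rewrite [- (_ + _ *m A)]opprD addrACA subrr addr0 mulmxBl mulmxBr !mulmxA.
by rewrite [in RHS]addrC subrKA opprB.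
Qed.

(** Since XA - AX is a multiple of X^2, each commutator with A raises the order
    in X of a polynomial in X. *)
Lemma iter_commutator_nilpotent n (A X : 'M[F]_n) p (g : {poly F}) :
  (1 < p)%N -> nilpotent_solution p g A X ->
  exists N, iter N (fun Z => A *m Z - Z *m A) X = 0.
Proof.
case: n A X => [|n] A X p_gt1 [[N XN0]]; first by exists 0%N; apply/matrixP => - [].
rewrite expmx_mul_horner_sqmx horner_sqmxE => eqX; exists N.
suff [q ->] : exists q : {poly F},
    iter N (fun Z => A *m Z - Z *m A) X = horner_mx X ('X^(N.+1) * q).
  by rewrite exprS -mulrA mulrCA rmorphM rmorphXn /= horner_mx_X XN0 mul0r.
elim: N {XN0} => [|N [q IH]]; first by exists 1; rewrite mulr1 horner_mx_X.
(* Minus the derivative of X^(N+1) q, times X^p g, divided by X^(N+2). *)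
exists (- (q *+ N.+1 + 'X * q^`()) * 'X^(p - 2) * g).
rewrite iterS IH (commutator_horner_mx _ eqX) -rmorphN; congr horner_mx.
rewrite derivM derivXn /= -[in 'X^p](subnKC p_gt1) exprD !exprS expr0; ring.
Qed.

Lemma iter_commutator_mxblock k (al : 'I_k -> nat)
    (C : forall i, 'M[F]_(al i)) (B : forall i j, 'M[F]_(al i, al j)) N :
  iter N (fun Z => \mxdiag_i C i *m Z - Z *m \mxdiag_i C i) (\mxblock_(i, j) B i j) =
  \mxblock_(i, j) iter N (fun Z => C i *m Z - Z *m C j) (B i j).
Proof.
elim: N => // N IH; rewrite iterS IH mul_mxdiag_mxblock mul_mxblock_mxdiag.
by rewrite -mxblockB.
Qed.

Lemma nilpotent_solution_block_diag k (lam : 'I_k -> F) n (al : 'I_k -> nat)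
    (en : (\sum_(i < k) al i)%N = n) (Y : 'M[F]_n) p (g : {poly F}) :
  injective lam -> (1 < p)%N ->
  nilpotent_solution p g (block_diag en (fun i => jordan_block (al i) (lam i))) Y ->
  exists B, Y = block_diag en B.
Proof.
move=> lam_inj p_gt1; rewrite /block_diag; case: _ / en Y => Y; rewrite castmx_id.
case/(iter_commutator_nilpotent p_gt1) => N.
rewrite -{1}[Y]submxblockK iter_commutator_mxblock -mxblock0 => /eq_mxblockP Y0.
exists (fun i => submxblock Y i i); rewrite castmx_id -[LHS]submxblockK.
apply: eq_mxblock => i j; case: eqVneq => [<-|ij]; first by rewrite conform_mx_id.
have lam_ij : lam i != lam j by rewrite (inj_eq lam_inj).
have := Y0 i j; elim: N {Y0} => // N IH.
by rewrite iterS => /(jordan_block_sylvester lam_ij).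
Qed.

(** Every nilpotent solution comes from the block-by-block calculation; the
    converse is [block_solutions_nilpotent_solution]. *)
Lemma nilpotent_solution_classification k (lam : 'I_k -> F) n (al : 'I_k -> nat)
    (en : (\sum_(i < k) al i)%N = n) (A P X : 'M[F]_n) p (g : {poly F}) :
  injective lam -> (1 < p)%N -> jordan_reduction lam en A P ->
  nilpotent_solution p g A X ->
  exists B : forall i : 'I_k, 'M[F]_(al i),
    invmx P *m X *m P = block_diag en B /\
    (forall i : 'I_k,
       [/\ nilpotent_solution p g (nilp_jordan F (al i)) (B i),
           strictly_upper (B i),
           admissible p g (last_col (B i))
         & B i = block_solution p g (last_col (B i))]).
Proof.
move=> lam_inj p_gt1 [uP AP] solX.
have conjE (Z : 'M[F]_n) : Z *m P = P *m (invmx P *m Z *m P).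
  by rewrite !mulmxA mulmxV // mul1mx.
have := nilpotent_solution_conj p g uP (conjE A) (conjE X).
rewrite AP => -[/(_ solX) solY _].
have [B BE] := nilpotent_solution_block_diag lam_inj p_gt1 solY.
exists B; split=> // i; move: solY.
rewrite BE => /block_diag_nilpotent_solution/(_ i) /nilpotent_solution_shift solB.
by have [upB admB BiE] := nilpotent_block_solution p_gt1 solB.
Qed.

Lemma block_solutions_nilpotent_solution k (lam : 'I_k -> F) n (al : 'I_k -> nat)
    (en : (\sum_(i < k) al i)%N = n) (A P : 'M[F]_n) p (g : {poly F})
    (u : forall i : 'I_k, 'cV[F]_(al i).-1) :
  (1 < p)%N -> jordan_reduction lam en A P ->
  (forall i, admissible p g (u i)) ->
  nilpotent_solution p g A
    (P *m block_diag en (fun i => block_solution p g (u i)) *m invmx P).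
Proof.
move=> p_gt1 [uP AP] adm; set Y := block_diag en _.
apply/(@nilpotent_solution_conj _ p g n A (invmx P *m A *m P) _ Y P uP).
- by rewrite !mulmxA mulmxV // mul1mx.
- by rewrite mulmxKV.
rewrite AP; apply/block_diag_nilpotent_solution => i.
by apply/nilpotent_solution_shift; apply: block_solution_solution.
Qed.

End IteratedCommutator.

(** * Spectral data of a non-derogatory matrix *)

Section JordanData.
Context {F : fieldType}.

Lemma horner_sqmx_eigenvector n m (A : 'M[F]_n) a (v : 'M[F]_(n, m)) q :
  A *m v = a *: v -> horner_sqmx A q *m v = q.[a] *: v.
Proof.
move=> Av; have AeV e : A ^+ e *m v = a ^+ e *: v.
  elim: e => [|e IH]; first by rewrite !expr0 mul1mx scale1r.
  by rewrite !exprS -mulmxE -mulmxA IH -scalemxAr Av scalerA mulrC.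
rewrite mulmx_suml horner_coef scaler_suml; apply: eq_bigr => i _.
by rewrite -scalemxAl AeV scalerA.
Qed.

Lemma jordan_block_mulmx_delta m a :
  jordan_block m.+1 a *m (delta_mx ord0 ord0 : 'cV[F]_m.+1) =
  a *: delta_mx ord0 ord0.
Proof.
rewrite mulmxDl mul_scalar_mx -colE; apply/matrixP => i j; rewrite !mxE.
by rewrite addr0.
Qed.

Lemma horner_jordan_block_neq0 m a (h : {poly F}) : (0 < m)%N -> h.[a] != 0 ->
  horner_sqmx (jordan_block m a) (('X - a%:P) ^+ m.-1 * h) != 0.
Proof.
case: m => // m _ ha; rewrite horner_sqmxE mulrC rmorphM rmorphXn /=.
rewrite rmorphB /= horner_mx_X horner_mx_C [jordan_block _ _ - _]addrC addKr.
apply/eqP => /(congr1 (fun M => M *m (delta_mx ord_max ord0 : 'cV_m.+1))).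
(* N^m sends the last basis vector to the first one, an eigenvector. *)
rewrite mul0mx -mulmxE -mulmxA.
have -> : nilp_jordan F m.+1 ^+ m *m delta_mx ord_max ord0 =
    delta_mx ord0 ord0 :> 'cV_m.+1.
  rewrite -colE; apply/matrixP => i j.
  rewrite !mxE expmx_nilp_jordan ord1 eqxx andbT.
  by rewrite -{1}[nat_of_ord ord_max]add0n eqn_add2r eq_sym.
rewrite -horner_sqmxE (horner_sqmx_eigenvector _ (jordan_block_mulmx_delta m a)).
move=> /matrixP/(_ ord0 ord0); rewrite !mxE eqxx mulr1 => ha0.
by rewrite ha0 eqxx in ha.
Qed.

Lemma char_poly_block_diag_jordan n k (lam : 'I_k -> F) (al : 'I_k -> nat)
    (en : (\sum_(i < k) al i)%N = n) :
  char_poly (block_diag en (fun i => jordan_block (al i) (lam i))) =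
  \prod_(i < k) ('X - (lam i)%:P) ^+ al i.
Proof.
rewrite /block_diag; case: _ / en; rewrite castmx_id.
set M := mxdiag _; have -> : char_poly M = char_poly M^T.
  rewrite /char_poly -det_tr; congr (\det _); apply/matrixP => i j.
  by rewrite !mxE eq_sym.
have trM : is_trig_mx M^T.
  rewrite tr_mxdiag; apply/is_trig_mxblockP; split=> [i j ij|i].
    by rewrite -val_eqE ltn_eqF.
  rewrite eqxx conform_mx_id; apply/is_trig_mxP => a b ab.
  by rewrite !mxE -val_eqE gtn_eqF // mulr0n add0r ltn_eqF // ltnS ltnW.
rewrite char_poly_trig //.
transitivity (\prod_(i < k) \prod_(s < al i) ('X - (lam i)%:P)); last first.
  by apply: eq_bigr => i _; rewrite prodr_const card_ord.
rewrite sig_big_dep (reindex _ tagnat.sig_bij_on) /=.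
apply: eq_bigr => s _; rewrite !mxE eqxx conform_mx_id !mxE eqxx.
by rewrite ltn_eqF // addr0.
Qed.

Lemma jordan_reduction_char_poly n k (lam : 'I_k -> F) (al : 'I_k -> nat)
    (en : (\sum_(i < k) al i)%N = n) (A P : 'M[F]_n) :
  jordan_reduction lam en A P ->
  char_poly A = \prod_(i < k) ('X - (lam i)%:P) ^+ al i.
Proof.
move=> [uP AP]; rewrite -(char_poly_block_diag_jordan lam en) -AP.
have detP : \det (map_mx polyC P) \is a GRing.unit.
  by rewrite det_map_mx rmorph_unit // -unitmxE.
rewrite /char_poly; apply: (mulrI detP); rewrite [LHS]mulrC -!det_mulmx.
congr (\det _); rewrite /char_poly_mx mulmxBl mulmxBr scalar_mxC -!map_mxM /=.
by rewrite !mulmxA mulmxV // mul1mx.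
Qed.

Lemma mup_prod_XsubC k (lam : 'I_k -> F) (al : 'I_k -> nat) i : injective lam ->
  mup (lam i) (\prod_(l < k) ('X - (lam l)%:P) ^+ al l) = al i.
Proof.
move=> lam_inj; rewrite (bigD1 i) //= mupMl.
  by rewrite mup_XsubCX eqxx.
rewrite /root horner_prod; apply/prodf_neq0 => l li.
rewrite horner_exp expf_neq0 // !hornerE subr_eq0; by rewrite (inj_eq lam_inj) eq_sym.
Qed.

Lemma root_prod_XsubC_exp k (lam : 'I_k -> F) (al : 'I_k -> nat) x :
  (forall i, 0 < al i)%N ->
  root (\prod_(l < k) ('X - (lam l)%:P) ^+ al l) x <-> exists i, x = lam i.
Proof.
move=> al_gt0; rewrite /root horner_prod; split.
  by case/prodf_eq0 => i _; rewrite horner_exp expf_eq0 !hornerE subr_eq0;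
     case/andP=> _ /eqP ->; exists i.
case=> i ->; apply/prodf_eq0; exists i => //.
by rewrite horner_exp expf_eq0 al_gt0 !hornerE subrr eqxx.
Qed.

(** A non-derogatory matrix is not annihilated by a polynomial in which the order
    of an eigenvalue is exactly one less than its algebraic multiplicity. *)
Lemma non_derogatory_spectrum n (A : 'M[F]_n) k (lam : 'I_k -> F)
    (al : 'I_k -> nat) :
  non_derogatory A -> injective lam ->
  (forall x, eigenvalue A x <-> exists i, x = lam i) ->
  (forall i, al i = mup (lam i) (char_poly A)) ->
  [/\ (\sum_(i < k) al i)%N = n,
      char_poly A = \prod_(i < k) ('X - (lam i)%:P) ^+ al i,
      forall i, (0 < al i)%N
    & forall i h, h.[lam i] != 0 ->
        horner_sqmx A (('X - (lam i)%:P) ^+ (al i).-1 * h) != 0].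
Proof.
move=> [k' [lam' [al' [en' [P [lam'_inj al'_gt0 jorP]]]]]] lam_inj spec mult.
have chiA := jordan_reduction_char_poly jorP.
have spec' x : (exists i, x = lam' i) <-> exists i, x = lam i.
  rewrite -spec eigenvalue_root_char chiA.
  exact: iff_sym (root_prod_XsubC_exp _ _ al'_gt0).
(* The given list of eigenvalues is a reindexing of the one in the Jordan form. *)
have /fin_all_exists[s lamE] i : exists i', lam i = lam' i'.
  by apply/spec'; exists i.
have /fin_all_exists[t lam'E] i' : exists i, lam' i' = lam i.
  by apply/spec'; exists i'.
have bij_s : bijective s.
  by exists t => i; [apply: lam_inj|apply: lam'_inj]; rewrite -?lam'E -?lamE.
have alE i : al i = al' (s i) by rewrite mult chiA lamE mup_prod_XsubC.
split=> [||i|i h hi]; last 2 first.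
- by rewrite alE.
- have [uP AP] := jorP; have AP' : A *m P = P *m (invmx P *m A *m P).
    by rewrite !mulmxA mulmxV // mul1mx.
  apply/eqP => A0; have := horner_sqmx_intertwine
    (('X - (lam i)%:P) ^+ (al i).-1 * h) AP'.
  rewrite A0 mul0mx AP horner_block_diag -(mulmx0 _ P) => /(can_inj (mulKmx uP)).
  rewrite -(block_diag0 en') => /esym/block_diag_inj/(_ (s i)); apply/eqP.
  by rewrite lamE alE horner_jordan_block_neq0 -?lamE.
- by rewrite -en' (reindex s) //=; [apply: eq_bigr|exact: onW_bij].
- rewrite chiA (reindex s) //=; last exact: onW_bij.
  by apply: eq_bigr => i _; rewrite lamE alE.
Qed.

End JordanData.

(** * A Jordan basis rational over the coefficients and the eigenvalues *)

Section RowBlocks.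
Context {F : fieldType} {m n k : nat} {al : 'I_k -> nat}.
Variable en : (\sum_(i < k) al i)%N = n.
Implicit Types (C : forall i : 'I_k, 'M[F]_(m, al i)).

(** The matrix whose i-th block of columns is [C i]. *)
Definition row_blocks C : 'M[F]_(m, n) := castmx (erefl, en) (\mxrow_i C i).

Lemma row_blocks_intertwine (A : 'M[F]_m) C (D : forall i : 'I_k, 'M[F]_(al i)) :
  (forall i, A *m C i = C i *m D i) ->
  A *m row_blocks C = row_blocks C *m block_diag en D.
Proof.
move=> AC; rewrite /row_blocks /block_diag; case: _ / en.
rewrite !castmx_id mul_mxrow mul_mxrow_mxdiag; exact: eq_mxrow.
Qed.

Lemma row_blocks_mulmx C (v : 'cV[F]_n) : exists v_ : forall i : 'I_k, 'cV[F]_(al i),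
  row_blocks C *m v = \sum_i C i *m v_ i /\ ((forall i, v_ i = 0) -> v = 0).
Proof.
rewrite /row_blocks; case: _ / en v => v; exists (submxcol v); rewrite castmx_id.
rewrite -{1}[v]submxcolK mul_mxrow_mxcol; split=> // v0.
by apply/mxcolP => i; rewrite v0 submxcol0.
Qed.

Lemma row_blocksE C r s : exists i l, row_blocks C r s = C i r l.
Proof.
rewrite /row_blocks; case: _ / en s => s; rewrite castmx_id mxE.
by do 2 eexists.
Qed.

End RowBlocks.

Section RationalJordanBasis.
Context {F : fieldType} {n k : nat}.
Variables (A : 'M[F]_n.+1) (lam : 'I_k -> F) (al : 'I_k -> nat).
Hypothesis chiA : char_poly A = \prod_(i < k) ('X - (lam i)%:P) ^+ al i.

(** The cofactor of the eigenvalue [lam i] in the characteristic polynomial. *)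
Let q_ i := \prod_(l < k | l != i) ('X - (lam l)%:P) ^+ al l.

(** The Jordan chain generated by q_i(A) e_c, as the columns of a matrix; the
    exponents of A - lam i decrease to 0, so that A - lam i kills the first
    column. *)
Definition jordan_chain i (c : 'I_n.+1) : 'M[F]_(n.+1, al i) :=
  \matrix_(r, s) horner_mx A (('X - (lam i)%:P) ^+ ((al i).-1 - s) * q_ i) r c.

Lemma mulmx_jordan_chain q i c (r : 'I_n.+1) (s : 'I_(al i)) :
  (horner_mx A q *m jordan_chain i c) r s =
  horner_mx A (q * (('X - (lam i)%:P) ^+ ((al i).-1 - s) * q_ i)) r c.
Proof.
rewrite [horner_mx A (q * _)]rmorphM -mulmxE !mxE.
by apply: eq_bigr => l _; rewrite mxE.
Qed.

Lemma jordan_chainP i c :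
  A *m jordan_chain i c = jordan_chain i c *m jordan_block (al i) (lam i).
Proof.
apply/matrixP => r s.
rewrite -[A in LHS]horner_mx_X mulmx_jordan_chain mulmxDr mul_mx_scalar [RHS]mxE.
rewrite [X in _ = X + _]mxE [X in _ = _ * X + _]mxE.
set h := _ * q_ i; have -> : 'X * h = lam i *: h + ('X - (lam i)%:P) * h.
  by rewrite -mul_polyC; ring.
rewrite rmorphD /= [X in X = _]mxE linearZ /= [X in X + _ = _]mxE; congr (_ + _).
rewrite /h mulrA -exprS.
have ai_gt0 : (0 < al i)%N := leq_ltn_trans (leq0n s) (ltn_ord s).
case: (posnP s) => [s0|s_gt0].
  rewrite mulmx_nilp_jordan0 // s0 subn0 prednK //.
  have -> : ('X - (lam i)%:P) ^+ al i * q_ i = char_poly A.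
    by rewrite chiA (bigD1 i).
  by rewrite Cayley_Hamilton mxE.
have lts : (s.-1 < al i)%N by rewrite prednK // ltnW.
rewrite (@mulmx_nilp_jordan _ _ _ _ _ (Ordinal lts)) /= ?prednK // mxE /=.
by congr (horner_mx A (_ ^+ _ * _) r c); have := ltn_ord s; lia.
Qed.

Lemma cofactor_mul_jordan_chain i l c :
  l != i -> horner_mx A (q_ l) *m jordan_chain i c = 0.
Proof.
move=> li; apply/matrixP => r s; rewrite mulmx_jordan_chain [RHS]mxE.
have -> : q_ l * (('X - (lam i)%:P) ^+ ((al i).-1 - s) * q_ i) =
    char_poly A * (\prod_(j < k | (j != l) && (j != i)) ('X - (lam j)%:P) ^+ al j *
      ('X - (lam i)%:P) ^+ ((al i).-1 - s)).
  by rewrite chiA /q_ (bigD1 i) 1?eq_sym //= [in RHS](bigD1 i) //=; ring.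
by rewrite rmorphM /= Cayley_Hamilton mul0r mxE.
Qed.

Hypothesis lam_inj : injective lam.

Lemma horner_cofactor_neq0 i : (q_ i).[lam i] != 0.
Proof.
rewrite horner_prod; apply/prodf_neq0 => l li; rewrite horner_exp expf_neq0 //.
by rewrite !hornerE subr_eq0 (inj_eq lam_inj) eq_sym.
Qed.

(** From a nontrivial relation between the images of the columns under q_i(A), a
    power of A - lam i gives q_i(A) w = 0 for the first column w.  But w is an
    eigenvector, on which q_i(A) acts by a nonzero scalar. *)
Lemma jordan_chain_free i c (v : 'cV[F]_(al i)) :
  col c (horner_mx A (('X - (lam i)%:P) ^+ (al i).-1 * q_ i)) != 0 ->
  horner_mx A (q_ i) *m (jordan_chain i c *m v) = 0 -> v = 0.
Proof.
set w := col c _ => wn0; set Q := horner_mx A (q_ i) => QCv0.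
apply/eqP; apply: contraNT wn0 => vn0.
have CE r s : jordan_chain i c r s =
    horner_mx A (('X - (lam i)%:P) ^+ ((al i).-1 - s) * q_ i) r c by rewrite mxE.
move: (jordan_chainP i c) CE; rewrite /w.
move: (jordan_chain i c) v QCv0 vn0; rewrite {w}.
case: (al i) => [|m] C v QCv0 vn0 CJ CE.
  by case/eqP: vn0; apply/matrixP => - [].
have {CJ} NC : (A - (lam i)%:M) *m C = C *m nilp_jordan F m.+1.
  by rewrite mulmxBl CJ mulmxDr mul_mx_scalar mul_scalar_mx addrAC subrr add0r.
have [s [a an0 sv]] := expmx_nilp_jordan_delta vn0.
have QC0 : Q *m col ord0 C = 0.
  have QN : Q *m (A - (lam i)%:M) ^+ s = (A - (lam i)%:M) ^+ s *m Q.
    apply: comm_mx_expmx; apply: comm_horner_mx.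
    by rewrite /comm_mx mulmxBl mulmxBr scalar_mxC.
  apply: (scalerI an0); rewrite scaler0 scalemxAr colE scalemxAr -sv.
  rewrite [C *m _]mulmxA -(expmx_intertwine s NC) -mulmxA [Q *m _]mulmxA QN.
  by rewrite -mulmxA QCv0 mulmx0.
have AC0 : A *m col ord0 C = lam i *: col ord0 C.
  apply/eqP; rewrite -subr_eq0 -mul_scalar_mx -mulmxBl colE mulmxA NC -mulmxA.
  rewrite (_ : nilp_jordan F m.+1 *m _ = 0) ?mulmx0 //.
  by rewrite -colE; apply/matrixP => a' b; rewrite !mxE.
suff <- : col ord0 C = col c (horner_mx A (('X - (lam i)%:P) ^+ m * q_ i)).
  move: QC0; rewrite /Q -horner_sqmxE (horner_sqmx_eigenvector _ AC0) => /eqP.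
  by rewrite scaler_eq0 (negPf (horner_cofactor_neq0 i)).
by apply/matrixP => r z; rewrite mxE CE subn0 [RHS]mxE.
Qed.

(** The columns of the matrices [jordan_chain], one for each eigenvalue and with
    suitable indices [c i], form a Jordan basis. *)
Lemma jordan_basis_exists (en : (\sum_(i < k) al i)%N = n.+1) :
  (forall i h, h.[lam i] != 0 ->
     horner_mx A (('X - (lam i)%:P) ^+ (al i).-1 * h) != 0) ->
  exists P, jordan_reduction lam en A P /\
    exists c : 'I_k -> 'I_n.+1,
      forall r s, exists i l, P r s = jordan_chain i (c i) r l.
Proof.
move=> ann.
have /fin_all_exists[c cn0] i : exists c : 'I_n.+1,
    col c (horner_mx A (('X - (lam i)%:P) ^+ (al i).-1 * q_ i)) != 0.
  apply/existsP; have := ann i _ (horner_cofactor_neq0 i).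
  apply: contraNT; rewrite negb_exists => /forallP c0.
  apply/eqP/matrixP => a b; have := c0 b; rewrite negbK => /eqP/matrixP/(_ a 0).
  by rewrite !mxE.
pose C i := jordan_chain i (c i); exists (row_blocks en C).
have PE := row_blocks_intertwine en (fun i => jordan_chainP i (c i)).
have uP : row_blocks en C \in unitmx.
  rewrite -unitmx_tr -row_free_unit -kermx_eq0; apply/eqP/row_matrixP => j.
  rewrite row0 -[row j _]trmxK; set v := (row j _)^T.
  have Pv0 : row_blocks en C *m v = 0.
    by rewrite -[row_blocks en C]trmxK -trmx_mul -row_mul mulmx_ker row0 trmx0.
  suff -> : v = 0 by rewrite trmx0.
  (* q_i(A) kills the chains of the other eigenvalues. *)
  have [v_ [PvE]] := row_blocks_mulmx en C v; apply=> i.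
  apply: (jordan_chain_free (cn0 i)).
  have := congr1 (mulmx (horner_mx A (q_ i))) PvE.
  rewrite Pv0 mulmx0 mulmx_sumr (bigD1 i) //= big1 ?addr0 // => l li.
  by rewrite mulmxA cofactor_mul_jordan_chain ?mul0mx // eq_sym.
split; first by split=> //; rewrite -mulmxA PE mulKmx.
by exists c => r s; apply: row_blocksE.
Qed.

End RationalJordanBasis.

(** * Field of definition *)

Section FieldOfDefinition.
Context {F : fieldType}.

Lemma in_QadjoinP (S : F -> Prop) x :
  (forall K : divringClosed F, (forall y, S y -> y \in K) -> x \in K) ->
  in_Qadjoin S x.
Proof.
move=> SK K closedK; pose K_mixin := GRing.isDivringClosed.Build F K closedK.
by pose K' : divringClosed F := HB.pack K K_mixin; apply: (SK K').
Qed.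

Lemma in_QadjoinW (S : F -> Prop) x (K : divringClosed F) :
  in_Qadjoin S x -> (forall y, S y -> y \in K) -> x \in K.
Proof.
apply; split; [exact: rpred1|exact: rpredB|exact: rpred_div].
Qed.

Variable K : divringClosed F.

Lemma mxOver_entry m n (X : 'M[F]_(m, n)) i j : X \is a mxOver K -> X i j \in K.
Proof. by move=> /mxOverP. Qed.

Lemma mxOver_expmx m (X : 'M[F]_m) e : X \is a mxOver K -> X ^+ e \is a mxOver K.
Proof. by move=> KX; rewrite rpredX. Qed.

Lemma mxOver_nilp_jordan m : nilp_jordan F m \is a mxOver K.
Proof. by apply/mxOverP => i j; rewrite mxE rpred_nat. Qed.

Lemma mxOver_horner_sqmx m (X : 'M[F]_m) q :
  X \is a mxOver K -> q \is a polyOver K -> horner_sqmx X q \is a mxOver K.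
Proof.
move=> KX /polyOverP Kq; apply: rpred_sum => i _.
by rewrite mxOverZ ?mxOver_expmx.
Qed.

Lemma det_mxOver m (X : 'M[F]_m) : X \is a mxOver K -> \det X \in K.
Proof.
move=> /mxOverP KX; apply: rpred_sum => s _; rewrite rpredMsign.
by apply: rpred_prod => i _.
Qed.

Lemma mxOver_invmx m (X : 'M[F]_m) : X \is a mxOver K -> invmx X \is a mxOver K.
Proof.
move=> KX; rewrite /invmx; case: ifP => // _.
apply: mxOverZ; first by rewrite rpredV det_mxOver.
apply/mxOverP => i j; rewrite mxE /cofactor rpredMsign det_mxOver //.
by apply/mxOverP => a b; rewrite !mxE (mxOverP KX).
Qed.

Lemma mxOver_trmx m n (X : 'M[F]_(m, n)) : X \is a mxOver K -> X^T \is a mxOver K.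
Proof. by move=> /mxOverP KX; apply/mxOverP => i j; rewrite mxE. Qed.

Lemma mxOver_block_diag n k (al : 'I_k -> nat) (en : (\sum_(i < k) al i)%N = n)
    (B : forall i : 'I_k, 'M[F]_(al i)) :
  (forall i, B i \is a mxOver K) -> block_diag en B \is a mxOver K.
Proof.
move=> KB; rewrite /block_diag; case: _ / en; rewrite castmx_id.
apply/mxOverP => i j; rewrite mxE; case: eqVneq => [e|_]; last by rewrite mxE rpred0.
move: (tagnat.sig1 j) (tagnat.sig2 j) e => l b e; case: _ / e b => b.
by rewrite conform_mx_id (mxOverP (KB _)).
Qed.

Lemma mxOver_block_solution p (g : {poly F}) m (u : 'cV[F]_m.-1) :
  g \is a polyOver K -> u \is a mxOver K -> block_solution p g u \is a mxOver K.
Proof.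
move=> Kg Ku; have KJ := mxOver_nilp_jordan m.
have Kka : kappa p g \in K by apply/polyOverP; rewrite rpredM ?polyOverXn.
rewrite /block_solution; have : last_col_mx u \is a mxOver K.
  apply/mxOverP => i j; rewrite mxE; case: ifP => _; last exact: rpred0.
  by case: insubP => [r _ _|_] /=; [rewrite (mxOverP Ku)|rewrite rpred0].
elim: (solving_order m) (last_col_mx u) => //= -[i j] s IH Y KY; apply: IH.
rewrite rpredD // mxOverZ //; last by apply/mxOverP => a b; rewrite mxE rpred_nat.
rewrite /entry_solution rpred_div ?rpredD ?rpred1 //.
- by apply: mxOver_entry; rewrite !mxOverM ?mxOver_trmx.
- apply: mxOver_entry.
  by rewrite !mxOverM ?mxOver_trmx ?mxOver_expmx ?mxOver_horner_sqmx.
- by rewrite rpredN rpredM //; apply: mxOver_entry; rewrite mxOverM ?mxOver_trmx.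
Qed.

Lemma jordan_chain_in n k (A : 'M[F]_n.+1) (lam : 'I_k -> F) (al : 'I_k -> nat)
    i c r s :
  A \is a mxOver K -> (forall i, lam i \in K) -> jordan_chain A lam al i c r s \in K.
Proof.
move=> KA Klam; rewrite mxE -horner_sqmxE; apply: mxOver_entry.
have KX l : 'X - (lam l)%:P \is a polyOver K by rewrite polyOverXsubC.
rewrite mxOver_horner_sqmx // rpredM ?rpredX ?KX //.
by rewrite rpred_prod // => l _; rewrite rpredX ?KX.
Qed.

End FieldOfDefinition.

(** * The nilpotent solutions of XA - AX = X^p g(X) *)

Theorem theorem5 (R : realType) (n p : nat) (g : {poly R[i]}) (A : 'M[R[i]]_n)
    (k : nat) (lam : 'I_k -> R[i]) (al : 'I_k -> nat)
    (hn : (2 <= n)%N) (hp : (2 <= p <= n - 1)%N)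
    (hg0 : g.[0] != 0) (hg : ((size g).-1 < n - p)%N)
    (hA : non_derogatory A)
    (hlam : injective lam)
    (hspec : forall x : R[i], eigenvalue A x <-> exists i : 'I_k, x = lam i)
    (hal : forall i : 'I_k, al i = mup (lam i) (char_poly A)) :
  exists en : (\sum_(i < k) al i)%N = n,
  [/\ (* a Jordan reduction with coefficients in Q(A, lam) exists *)
      exists P : 'M[R[i]]_n,
        jordan_reduction lam en A P /\
        (forall r c, in_Qadjoin (data_gens A lam) (P r c)),
      (* block-by-block determination of all the nilpotent solutions *)
      forall P : 'M[R[i]]_n, jordan_reduction lam en A P ->
        (forall X : 'M[R[i]]_n, nilpotent_solution p g A X ->
           exists B : forall i : 'I_k, 'M[R[i]]_(al i),
             invmx P *m X *m P = block_diag en B /\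
             (forall i : 'I_k,
                [/\ nilpotent_solution p g (nilp_jordan R[i] (al i)) (B i),
                    strictly_upper (B i),
                    admissible p g (last_col (B i))
                  & B i = block_solution p g (last_col (B i))])) /\
        (forall u : forall i : 'I_k, 'cV[R[i]]_(al i).-1,
           (forall i, admissible p g (u i)) ->
           nilpotent_solution p g A
             (P *m block_diag en (fun i => block_solution p g (u i)) *m invmx P) /\
           (forall i, last_col (block_solution p g (u i)) = u i)),
      (* field of definition of the solutions *)
      forall P : 'M[R[i]]_n, jordan_reduction lam en A P ->
        (forall r c, in_Qadjoin (data_gens A lam) (P r c)) ->
        forall (X : 'M[R[i]]_n) (B : forall i : 'I_k, 'M[R[i]]_(al i)),
          nilpotent_solution p g A X ->
          invmx P *m X *m P = block_diag en B ->
          forall r c,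
            in_Qadjoin (solution_gens g A lam (fun i => last_col (B i))) (X r c)
    & (* number of parameters *)
      (k <= n)%N /\ (\sum_(i < k) (al i).-1)%N = (n - k)%N].
Proof.
have p_gt1 : (1 < p)%N by case/andP: hp.
have [en chiA al_gt0 ann] := non_derogatory_spectrum hA hlam hspec hal.
exists en; split.
- clear hspec hal hA hp hg; case: n A hn en chiA ann => // m A' _ en chiA ann.
  have ann' i h : h.[lam i] != 0 ->
      horner_mx A' (('X - (lam i)%:P) ^+ (al i).-1 * h) != 0.
    by rewrite -horner_sqmxE; apply: ann.
  have [P [jorP [c PE]]] := jordan_basis_exists chiA hlam en ann'.
  exists P; split=> // r s; apply: in_QadjoinP => K KS.
  have [i [l ->]] := PE r s; apply: jordan_chain_in.
    by apply/mxOverP => a b; apply: KS; left; exists a, b.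
  by move=> i'; apply: KS; right; exists i'.
- move=> P jorP; split=> [X solX|u adm].
    exact: nilpotent_solution_classification hlam p_gt1 jorP solX.
  split; first exact: block_solutions_nilpotent_solution p_gt1 jorP adm.
  by move=> i; apply: last_col_block_solution.
- move=> P jorP KP X B solX XE r c; apply: in_QadjoinP => K KS.
  have [B' []] := nilpotent_solution_classification hlam p_gt1 jorP solX.
  rewrite XE => /block_diag_inj BE BP.
  have uP : P \in unitmx by case: jorP.
  have KP' : P \is a mxOver K.
    apply/mxOverP => a b; apply: in_QadjoinW (KP a b) _ => y Sy.
    by apply: KS; apply: Or31.
  have -> : X = P *m block_diag en B *m invmx P.
    by rewrite -XE !mulmxA mulmxV // mul1mx mulmxK.
  apply: mxOver_entry; rewrite !mxOverM ?mxOver_invmx // mxOver_block_diag // => i.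
  have [_ _ _] := BP i; rewrite -BE => ->; apply: mxOver_block_solution.
    by apply/polyOverP => s; apply: KS; apply: Or33; exists s.
  by apply/mxOverP => a b; rewrite ord1; apply: KS; apply: Or32; exists i, a.
have nE : (n = \sum_(i < k) (al i).-1 + k)%N.
  have kE : (\sum_(i < k) 1)%N = k by rewrite sum1_card card_ord.
  rewrite -[X in (_ + X)%N]kE -big_split /= -[in LHS]en.
  by apply: eq_bigr => i _; rewrite addn1 prednK.
by split; rewrite nE ?leq_addl ?addnK.
Qed.
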